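(* Let $n\ge3$, $t_1<\dots<t_n$, and for $j=1,\dots,n-1$ let $\lambda_{0,j}<0<\lambda_{1,j}$ be real and $\varphi_j=\Phi_{(\lambda_{0,j},\lambda_{1,j})}$. Let $H_1,\dots,H_n$ be the associated generalized hat functions and $\mathcal{H}_n$ their span. Then the matrix $(s_{i,j})$ with $s_{i,j}=\int_{t_1}^{t_n}H_iH_j\,dt$ is row diagonally dominant and $$\|P^{\mathcal{H}_n}\|_{op}\le2\max_{1\le j\le n-1}\max\left\{\frac{2\lambda_{1,j}-4\lambda_{0,j}}{-3\lambda_{0,j}},\frac{4\lambda_{1,j}-2\lambda_{0,j}}{3\lambda_{1,j}}\right\},$$ where $P^{\mathcal{H}_n}$ is the orthogonal projection onto $\mathcal{H}_n$ for the unweighted $L^2$ inner product on $[t_1,t_n]$.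
   Context: $\Phi_{(\lambda_0,\lambda_1)}(t)=\frac{e^{\lambda_1t}-e^{\lambda_0t}}{\lambda_1-\lambda_0}$ ($\lambda_0\ne\lambda_1$). Generalized hat functions: for $2\le j\le n-1$, $H_j(t)=\frac{\varphi_{j-1}(t-t_{j-1})}{\varphi_{j-1}(t_j-t_{j-1})}$ on $[t_{j-1},t_j]$, $H_j(t)=\frac{\varphi_j(t-t_{j+1})}{\varphi_j(t_j-t_{j+1})}$ on $[t_j,t_{j+1}]$, $0$ elsewhere; $H_1=\frac{\varphi_1(t-t_2)}{\varphi_1(t_1-t_2)}$ on $[t_1,t_2]$, $0$ elsewhere; $H_n=\frac{\varphi_{n-1}(t-t_{n-1})}{\varphi_{n-1}(t_n-t_{n-1})}$ on $[t_{n-1},t_n]$, $0$ elsewhere. $\|P^{\mathcal{H}_n}\|_{op}=\sup_{f\ne0}\|P^{\mathcal{H}_n}f\|_\infty/\|f\|_\infty$ on $C[t_1,t_n]$. Row diagonally dominant: there is $c\in(0,1)$ with $|s_{j-1,j}|+|s_{j,j+1}|\le c|s_{j,j}|$ for all $j$, where $s_{0,1}=s_{n,n+1}=0$. *)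

(* Defs.v *)
From Stdlib Require Import Reals Lra Lia List.
From Coquelicot Require Import Coquelicot.
Open Scope R_scope.

Definition Phi (l0 l1 t : R) : R := (exp (l1 * t) - exp (l0 * t)) / (l1 - l0).

(* Knots t : nat -> R used at indices 1..n; exponent pairs lam0 j, lam1 j used
   at indices j = 1..n-1; phi_j = Phi (lam0 j) (lam1 j). *)
Definition phi (lam0 lam1 : nat -> R) (j : nat) : R -> R := Phi (lam0 j) (lam1 j).

Definition in_cc (a b x : R) : Prop := a <= x <= b.

Definition hat (n : nat) (t lam0 lam1 : nat -> R) (j : nat) (x : R) : R :=
  let ph := phi lam0 lam1 in
  if Nat.eqb j 1 then
    (if Rle_dec (t 1%nat) x then if Rle_dec x (t 2%nat) then
       ph 1%nat (x - t 2%nat) / ph 1%nat (t 1%nat - t 2%nat) else 0 else 0)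
  else if Nat.eqb j n then
    (if Rle_dec (t (n-1)%nat) x then if Rle_dec x (t n) then
       ph (n-1)%nat (x - t (n-1)%nat) / ph (n-1)%nat (t n - t (n-1)%nat) else 0 else 0)
  else if andb (Nat.leb 2 j) (Nat.leb j (n-1)) then
    (if Rle_dec (t (j-1)%nat) x then
       (if Rle_dec x (t j) then
          ph (j-1)%nat (x - t (j-1)%nat) / ph (j-1)%nat (t j - t (j-1)%nat)
        else if Rle_dec x (t (j+1)%nat) then
          ph j (x - t (j+1)%nat) / ph j (t j - t (j+1)%nat)
        else 0)
     else 0)
  else 0.

Definition gram (n : nat) (t lam0 lam1 : nat -> R) (i j : nat) : R :=
  RInt (fun x => hat n t lam0 lam1 i x * hat n t lam0 lam1 j x) (t 1%nat) (t n).

Definition gram_ext (n : nat) (t lam0 lam1 : nat -> R) (i j : nat) : R :=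
  if orb (Nat.eqb i 0) (Nat.eqb j (n+1)) then 0 else gram n t lam0 lam1 i j.

Definition row_diag_dominant (n : nat) (s : nat -> nat -> R) : Prop :=
  exists c : R, 0 < c < 1 /\
    forall j : nat, (1 <= j <= n)%nat ->
      Rabs (s (j-1)%nat j) + Rabs (s j (j+1)%nat) <= c * Rabs (s j j).

Definition span_elt (n : nat) (t lam0 lam1 : nat -> R) (c : nat -> R) (x : R) : R :=
  sum_f_R0 (fun k => c (S k) * hat n t lam0 lam1 (S k) x) (n-1).

Definition is_orth_proj (n : nat) (t lam0 lam1 : nat -> R) (f g : R -> R) : Prop :=
  (exists c : nat -> R, forall x, g x = span_elt n t lam0 lam1 c x) /\
  forall i : nat, (1 <= i <= n)%nat ->
    RInt (fun x => (f x - g x) * hat n t lam0 lam1 i x) (t 1%nat) (t n) = 0.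

(* max_{1<=j<=n-1} max{ (2 l1 - 4 l0)/(-3 l0), (4 l1 - 2 l0)/(3 l1) }
   (all terms are positive, so the fold start value 0 is harmless) *)
Definition bound_term (l0 l1 : R) : R :=
  Rmax ((2 * l1 - 4 * l0) / (-3 * l0)) ((4 * l1 - 2 * l0) / (3 * l1)).

Definition max_bound (n : nat) (lam0 lam1 : nat -> R) : R :=
  fold_right Rmax 0 (map (fun j => bound_term (lam0 j) (lam1 j)) (seq 1 (n-1))).

(* Main.v *)
Require Import Defs.
From Stdlib Require Import Reals Lra Lia Psatz List.
From Coquelicot Require Import Coquelicot.
Open Scope R_scope.

(** On a knot interval of length [h] let [p] and [q] be the rising and the falling half of the
    hats, so that [p, q >= 0] and [p + q <= 1]. Everything rests on the local inequality
    [int p <= 2 B (int p^2 - int p q)] with [B = bound_term l0 l1], and its mirror image for [q].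
    Set [y = (l1 - l0) h / 2], [k = (l0 + l1) / (l1 - l0)], [w = sinh (k y) / (k sinh y)]
    (read as a limit if [k = 0]) and [A = exp (k y) (cosh y - k sinh y)]. The explicit integrals
    factor so that the inequality
    becomes [A - 1 <= B (1 - w) (A + 1)]. It follows from [1 - w >= (1 - k^2) (1 - y / sinh y)],
    [B (1 - k^2) >= 2] and the one-variable estimate [A <= 1 + 16/27 sinh^2 y].

    Diagonal dominance follows by summing over the knot intervals. For the projection
    [g = sum c_i H_i] of [f], take [m] with [|c_m|] maximal: the orthogonality of [f - g] to [H_m]
    and the local inequality give [|c_m| <= 2 max B |f|], and [|g| <= |c_m|] since [p + q <= 1]. *)

(** * Hyperbolic estimates *)

Lemma le_of_deriv_nonneg (f df : R -> R) (y : R) :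
  0 <= y ->
  (forall x, is_derive f x (df x)) ->
  (forall x, 0 <= x <= y -> 0 <= df x) ->
  f 0 <= f y.
Proof.
  intros Hy Hd Hp.
  destruct (MVT_gen f 0 y df) as [c [Hc Heq]].
  - intros x _. apply Hd.
  - intros x _. apply continuity_pt_filterlim, (ex_derive_continuous f).
    eexists; apply Hd.
  - rewrite Rmin_left, Rmax_right in Hc by lra.
    specialize (Hp c Hc). nra.
Qed.

(** Convexity of the exponential, obtained from [1 + u <= exp u] alone: the tangent at [z] is
    compared with the values at [0] and [h]. In the combination with weights [1 - r] and [r], where
    [z = r h], the linear terms cancel. *)
Lemma exp_chord (l h z : R) :
  0 < h -> 0 <= z <= h -> exp (l * z) <= 1 + (exp (l * h) - 1) * (z / h).
Proof.
  intros Hh Hz.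
  set (r := z / h).
  assert (Hr : 0 <= r <= 1).
  { unfold r; split.
    - apply Rle_div_r; lra.
    - apply Rle_div_l; lra. }
  assert (Ez : z = r * h) by (unfold r; field; lra).
  assert (H0 := exp_ineq1_le (- (l * z))).
  assert (H1 := exp_ineq1_le (l * h - l * z)).
  assert (Hp := exp_pos (l * z)).
  assert (E0 : exp (l * z) * exp (- (l * z)) = 1)
    by (rewrite <- exp_plus, Rplus_opp_r; apply exp_0).
  assert (E1 : exp (l * z) * exp (l * h - l * z) = exp (l * h))
    by (rewrite <- exp_plus; f_equal; ring).
  assert (H2 : exp (l * z) * (1 + - (l * z)) <= 1)
    by (rewrite <- E0; apply Rmult_le_compat_l; lra).
  assert (H3 : exp (l * z) * (1 + (l * h - l * z)) <= exp (l * h))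
    by (rewrite <- E1; apply Rmult_le_compat_l; lra).
  assert (H4 : exp (l * z) = (1 - r) * (exp (l * z) * (1 + - (l * z)))
                + r * (exp (l * z) * (1 + (l * h - l * z))))
    by (rewrite Ez; ring).
  rewrite H4. nra.
Qed.

Lemma sinh_odd (x : R) : sinh (- x) = - sinh x.
Proof. unfold sinh. rewrite Ropp_involutive. lra. Qed.

Lemma is_derive_sinh (x : R) : is_derive sinh x (cosh x).
Proof. unfold sinh, cosh. auto_derive; [easy | field]. Qed.

Lemma cosh_ge_1 (x : R) : 1 <= cosh x.
Proof.
  unfold cosh. assert (H := exp_ineq1_le x). assert (H' := exp_ineq1_le (- x)). lra.
Qed.

(** First rung of a ladder that starts from [cosh_ge_1]: the difference treated in each Taylor bound
    has as derivative the difference treated in the bound before it. The rung of degree 5 is what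
    [sinh_cubic_bound] consumes. *)
Lemma sinh_ge_id (y : R) : 0 <= y -> y <= sinh y.
Proof.
  intros Hy.
  assert (H := le_of_deriv_nonneg (fun u => sinh u - u) (fun u => cosh u - 1) y Hy).
  cbv beta in H. rewrite sinh_0 in H.
  enough (0 - 0 <= sinh y - y) by lra. apply H.
  - intros x. apply (is_derive_minus (V := R_NormedModule)); [apply is_derive_sinh |].
    apply (is_derive_id (K := R_AbsRing)).
  - intros x _. assert (Hc := cosh_ge_1 x). lra.
Qed.

Lemma cosh_ge_deg2 (y : R) : 0 <= y -> 1 + y ^ 2 / 2 <= cosh y.
Proof.
  intros Hy.
  assert (H := le_of_deriv_nonneg (fun u => cosh u - (1 + u ^ 2 / 2)) (fun u => sinh u - u) y Hy).
  cbv beta in H. rewrite cosh_0 in H.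
  enough (1 - (1 + 0 ^ 2 / 2) <= cosh y - (1 + y ^ 2 / 2)) by lra. apply H.
  - intros x. unfold cosh, sinh. auto_derive; [easy | field].
  - intros x Hx. assert (Hc := sinh_ge_id x). lra.
Qed.

Lemma sinh_ge_deg3 (y : R) : 0 <= y -> y + y ^ 3 / 6 <= sinh y.
Proof.
  intros Hy.
  assert (H := le_of_deriv_nonneg (fun u => sinh u - (u + u ^ 3 / 6))
                 (fun u => cosh u - (1 + u ^ 2 / 2)) y Hy).
  cbv beta in H. rewrite sinh_0 in H.
  enough (0 - (0 + 0 ^ 3 / 6) <= sinh y - (y + y ^ 3 / 6)) by lra. apply H.
  - intros x. unfold cosh, sinh. auto_derive; [easy | field].
  - intros x Hx. assert (Hc := cosh_ge_deg2 x). lra.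
Qed.

Lemma cosh_ge_deg4 (y : R) : 0 <= y -> 1 + y ^ 2 / 2 + y ^ 4 / 24 <= cosh y.
Proof.
  intros Hy.
  assert (H := le_of_deriv_nonneg (fun u => cosh u - (1 + u ^ 2 / 2 + u ^ 4 / 24))
                 (fun u => sinh u - (u + u ^ 3 / 6)) y Hy).
  cbv beta in H. rewrite cosh_0 in H.
  enough (1 - (1 + 0 ^ 2 / 2 + 0 ^ 4 / 24) <= cosh y - (1 + y ^ 2 / 2 + y ^ 4 / 24)) by lra.
  apply H.
  - intros x. unfold cosh, sinh. auto_derive; [easy | field].
  - intros x Hx. assert (Hc := sinh_ge_deg3 x). lra.
Qed.

Lemma sinh_ge_deg5 (y : R) : 0 <= y -> y + y ^ 3 / 6 + y ^ 5 / 120 <= sinh y.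
Proof.
  intros Hy.
  assert (H := le_of_deriv_nonneg (fun u => sinh u - (u + u ^ 3 / 6 + u ^ 5 / 120))
                 (fun u => cosh u - (1 + u ^ 2 / 2 + u ^ 4 / 24)) y Hy).
  cbv beta in H. rewrite sinh_0 in H.
  enough (0 - (0 + 0 ^ 3 / 6 + 0 ^ 5 / 120) <= sinh y - (y + y ^ 3 / 6 + y ^ 5 / 120)) by lra.
  apply H.
  - intros x. unfold cosh, sinh. auto_derive; [easy | field].
  - intros x Hx. assert (Hc := cosh_ge_deg4 x). lra.
Qed.

Lemma cosh_scal_le (k y : R) : 0 <= k <= 1 -> 0 <= y -> cosh (k * y) <= cosh y.
Proof.
  intros Hk Hy.
  set (d := y - k * y).
  assert (Hd : 0 <= d) by (unfold d; nra).
  assert (H2 := le_of_deriv_nonneg (fun u => cosh (k * y + u)) (fun u => sinh (k * y + u)) d Hd).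
  cbv beta in H2. replace (k * y + d) with y in H2 by (unfold d; ring).
  rewrite Rplus_0_r in H2. apply H2.
  - intros x. unfold cosh, sinh. auto_derive; [easy | field].
  - intros x Hx. assert (0 <= k * y) by nra.
    assert (Hs := sinh_ge_id (k * y + x)). lra.
Qed.

Lemma sinh_scal_le (k y : R) : 0 <= k <= 1 -> 0 <= y -> sinh (k * y) <= k * sinh y.
Proof.
  intros Hk Hy.
  assert (H := le_of_deriv_nonneg (fun u => k * sinh u - sinh (k * u))
                 (fun u => k * (cosh u - cosh (k * u))) y Hy).
  cbv beta in H. rewrite Rmult_0_r, sinh_0 in H.
  enough (k * 0 - 0 <= k * sinh y - sinh (k * y)) by lra. apply H.
  - intros x. unfold cosh, sinh. auto_derive; [easy | field].
  - intros x Hx. assert (Hc := cosh_scal_le k x Hk). nra.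
Qed.

(* [sinh (k y) / k] is a convex function of [k^2]; this is the chord between [k = 0] and [k = 1]. *)
Lemma sinh_scal_chord (k y : R) :
  0 <= k <= 1 -> 0 <= y -> sinh (k * y) <= k * (y + k ^ 2 * (sinh y - y)).
Proof.
  intros Hk Hy.
  assert (H1 : forall z, 0 <= z ->
             0 <= k * (1 + k ^ 2 * (cosh z - 1)) - k * cosh (k * z)).
  { intros z Hz.
    assert (H := le_of_deriv_nonneg
                   (fun u => k * (1 + k ^ 2 * (cosh u - 1)) - k * cosh (k * u))
                   (fun u => k ^ 2 * (k * sinh u - sinh (k * u))) z Hz).
    cbv beta in H. rewrite Rmult_0_r, cosh_0 in H.
    replace (k * (1 + k ^ 2 * (1 - 1)) - k * 1) with 0 in H by ring.
    apply H.
    - intros x. unfold cosh, sinh. auto_derive; [easy | field].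
    - intros x Hx. assert (Hc := sinh_scal_le k x Hk). nra. }
  assert (H := le_of_deriv_nonneg
                 (fun u => k * (u + k ^ 2 * (sinh u - u)) - sinh (k * u))
                 (fun u => k * (1 + k ^ 2 * (cosh u - 1)) - k * cosh (k * u)) y Hy).
  cbv beta in H. rewrite Rmult_0_r, sinh_0 in H.
  enough (k * (0 + k ^ 2 * (0 - 0)) - 0 <= k * (y + k ^ 2 * (sinh y - y)) - sinh (k * y)) by lra.
  apply H.
  - intros x. unfold cosh, sinh. auto_derive; [easy | field].
  - intros x Hx. apply H1; lra.
Qed.

(** The right side is the chord of [exp] over [[-y, y]]: the point [k y] has weight [(1 + k) / 2] at
    [y] and [(1 - k) / 2] at [-y]. *)
Lemma exp_scal_le (k y : R) :
  -1 <= k <= 1 -> 0 <= y -> exp (k * y) <= cosh y + k * sinh y.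
Proof.
  intros Hk [Hy | <-].
  2: { rewrite Rmult_0_r, exp_0, cosh_0, sinh_0; lra. }
  (* [exp_chord] starts at [0], so everything is translated by [y]; the factor [exp y] is divided
     out afterwards. *)
  assert (H := exp_chord 1 (2 * y) (y + k * y) ltac:(lra) ltac:(nra)).
  assert (Hy2 : exp (1 * (2 * y)) = exp y * exp y)
    by (rewrite <- exp_plus; f_equal; ring).
  assert (Hs : exp (1 * (y + k * y)) = exp y * exp (k * y))
    by (rewrite <- exp_plus; f_equal; ring).
  replace ((y + k * y) / (2 * y)) with ((1 + k) / 2) in H by (field; lra).
  rewrite Hy2, Hs in H.
  assert (Hm : exp y * exp (- y) = 1) by (rewrite <- exp_plus, Rplus_opp_r; apply exp_0).
  assert (Hp := exp_pos (- y)).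
  assert (H' := Rmult_le_compat_l _ _ _ (Rlt_le _ _ Hp) H).
  unfold cosh, sinh.
  replace (exp (- y) * (exp y * exp (k * y))) with (exp (k * y)) in H'
    by (rewrite <- Rmult_assoc, (Rmult_comm (exp (- y))), Hm; ring).
  replace (exp (- y) * (1 + (exp y * exp y - 1) * ((1 + k) / 2)))
    with (exp (- y) + (exp y * exp (- y) * exp y - exp (- y)) * ((1 + k) / 2)) in H' by ring.
  rewrite Hm in H'. lra.
Qed.

(** The left side has derivative [(1 - k^2) sinh y exp (k y)], so it suffices that
    [(1 - k^2) exp (k y) <= 32/27 cosh y]. By [exp_scal_le] and [sinh y <= cosh y] this comes down
    to the maximum of [(1 - k^2) (1 + k)] on [[0, 1]], which is [32/27]. *)
Lemma exp_cosh_sinh_le (k y : R) :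
  -1 <= k <= 1 -> 0 <= y ->
  exp (k * y) * (cosh y - k * sinh y) <= 1 + 16 / 27 * sinh y ^ 2.
Proof.
  intros Hk Hy.
  assert (H := le_of_deriv_nonneg
                 (fun u => 1 + 16 / 27 * sinh u ^ 2 - exp (k * u) * (cosh u - k * sinh u))
                 (fun u => sinh u * (32 / 27 * cosh u - (1 - k ^ 2) * exp (k * u))) y Hy).
  cbv beta in H. rewrite Rmult_0_r, sinh_0, cosh_0, exp_0 in H.
  enough (1 + 16 / 27 * 0 ^ 2 - 1 * (1 - k * 0) <=
            1 + 16 / 27 * sinh y ^ 2 - exp (k * y) * (cosh y - k * sinh y)) by lra.
  apply H.
  - intros x. unfold cosh, sinh. auto_derive; [easy | field].
  - intros x [Hx _].
    assert (He := exp_scal_le k x Hk Hx).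
    assert (Hs := sinh_ge_id x Hx).
    assert (Hsc : sinh x <= cosh x).
    { unfold sinh, cosh. assert (Hp := exp_pos (- x)). lra. }
    apply Rmult_le_pos; [lra|].
    assert (H1 : (1 - k ^ 2) * exp (k * x) <= (1 - k ^ 2) * (cosh x + k * sinh x))
      by (apply Rmult_le_compat_l; nra).
    enough ((1 - k ^ 2) * (cosh x + k * sinh x) <= 32 / 27 * cosh x) by lra.
    destruct (Rle_or_lt 0 k) as [Hk0 | Hk0].
    + assert ((1 - k ^ 2) * (cosh x + k * sinh x) <= (1 - k ^ 2) * (1 + k) * cosh x).
      { rewrite Rmult_assoc. apply Rmult_le_compat_l; nra. }
      assert ((1 - k ^ 2) * (1 + k) <= 32 / 27).
      (* The maximum is attained at [k = 1/3], which gives the double root in the factorization. *)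
      { enough (0 <= (k - 1 / 3) ^ 2 * (k + 5 / 3)) by nra.
        apply Rmult_le_pos; [apply pow2_ge_0 | lra]. }
      nra.
    + assert ((1 - k ^ 2) * (cosh x + k * sinh x) <= (1 - k ^ 2) * cosh x).
      { apply Rmult_le_compat_l; nra. }
      nra.
Qed.

(** With [S = y (1 + r)] and [y^2 = 6 v] the claim becomes [32/9 v (1 + r)^2 (1 - r) <= 4 r], and
    the Taylor hypothesis becomes [r >= v + 3/10 v^2]. The cubic in [r] is the one already met in
    [exp_cosh_sinh_le], again with maximum [32/27]. *)
Lemma sinh_cubic_bound (y S : R) :
  0 < y -> y + y ^ 3 / 6 + y ^ 5 / 120 <= S -> S < 2 * y ->
  (1 + 16 / 27 * S ^ 2) * (2 * y - S) <= 3 * S - 2 * y.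
Proof.
  intros Hy HS H2.
  set (r := S / y - 1). set (v := y ^ 2 / 6).
  assert (ES : S = y * (1 + r)) by (unfold r; field; lra).
  assert (Ev : y ^ 2 = 6 * v) by (unfold v; field).
  assert (Hv : 0 < v) by (unfold v; nra).
  assert (Hr : v + 3 / 10 * v ^ 2 <= r).
  { apply Rmult_le_reg_l with y; [lra|]. unfold v. nra. }
  assert (Hr1 : r < 1) by nra.
  enough (32 / 9 * v * ((1 + r) ^ 2 * (1 - r)) <= 4 * r).
  { assert (y * (32 / 9 * v * ((1 + r) ^ 2 * (1 - r))) <= y * (4 * r))
      by (apply Rmult_le_compat_l; lra).
    assert (S ^ 2 = 6 * v * (1 + r) ^ 2) by (rewrite ES, <- Ev; ring).
    rewrite H1, ES. nra. }
  assert (Hmax : (1 + r) ^ 2 * (1 - r) <= 32 / 27).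
  { enough (0 <= (r - 1 / 3) ^ 2 * (r + 5 / 3)) by nra.
    apply Rmult_le_pos; [apply pow2_ge_0 | nra]. }
  (* Using the maximum [32/27] requires [1024/243 v <= 4 v + 6/5 v^2], which holds from about
     [v = 0.18] on. For smaller [v] it is too wasteful, and [r] is instead compared with its lower
     bound [w]. *)
  destruct (Rle_or_lt (1 / 5) v) as [Hc | Hc].
  - assert (32 / 9 * v * ((1 + r) ^ 2 * (1 - r)) <= 32 / 9 * v * (32 / 27))
      by (apply Rmult_le_compat_l; lra).
    nra.
  - set (w := v + 3 / 10 * v ^ 2) in *.
    (* [4 r - 32/9 v (1+r)^2 (1-r)] is increasing in [r] as [v < 1/5] *)
    assert (Hw : 32 / 9 * ((1 + w) ^ 2 * (1 - w)) <= 4 + 6 / 5 * v) by (unfold w; nra).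
    assert (Hw2 : 32 / 9 * v * ((1 + w) ^ 2 * (1 - w)) <= 4 * w).
    { replace (4 * w) with (v * (4 + 6 / 5 * v)) by (unfold w; field). nra. }
    assert (Hmon : (1 + r) ^ 2 * (1 - r) - (1 + w) ^ 2 * (1 - w) <= r - w).
    { assert (0 <= w) by (unfold w; nra).
      assert (0 <= (r - w) * (r + w + r ^ 2 + r * w + w ^ 2)) by (apply Rmult_le_pos; nra).
      nra. }
    nra.
Qed.

(** This is the target [A - 1 <= B (1 - w) (A + 1)] after [B (1 - w)] has been replaced by its lower
    bound [2 (1 - y / sinh y)] and the denominator cleared. *)
Lemma exp_cosh_sinh_key (k y : R) :
  -1 <= k <= 1 -> 0 < y ->
  sinh y * (exp (k * y) * (cosh y - k * sinh y) - 1) <=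
  2 * (sinh y - y) * (exp (k * y) * (cosh y - k * sinh y) + 1).
Proof.
  intros Hk Hy.
  set (A := exp (k * y) * (cosh y - k * sinh y)).
  assert (HA : A <= 1 + 16 / 27 * sinh y ^ 2) by (apply exp_cosh_sinh_le; lra).
  assert (HS := sinh_ge_deg5 y ltac:(lra)).
  assert (HS1 := sinh_ge_id y ltac:(lra)).
  assert (HA0 : 0 <= A).
  { apply Rmult_le_pos; [left; apply exp_pos|].
    unfold cosh, sinh. assert (Hp := exp_pos y). assert (Hm := exp_pos (- y)). nra. }
  enough (A * (2 * y - sinh y) <= 3 * sinh y - 2 * y) by nra.
  (* If [sinh y >= 2 y], the left side is at most [0] because [A >= 0], while the right side is
     positive. Only otherwise is the upper bound on [A] of use. *)
  destruct (Rle_or_lt (2 * y) (sinh y)) as [Hc | Hc].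
  - nra.
  - assert (H := sinh_cubic_bound y (sinh y) Hy HS Hc).
    assert (A * (2 * y - sinh y) <= (1 + 16 / 27 * sinh y ^ 2) * (2 * y - sinh y))
      by (apply Rmult_le_compat_r; lra).
    lra.
Qed.

(** * Integrals on one knot interval *)

(** In terms of [k = (l0 + l1) / (l1 - l0)] the first entry of the maximum is
    [(6 - 2 k) / (3 (1 - k))]; multiplied by [1 - k^2] it gives [2 + 2 k (2 - k) / 3], which is at
    least [2] when [k >= 0]. The second entry is the same with [-k] for [k], and serves when
    [k < 0]. *)
Lemma bound_term_ge (l0 l1 : R) :
  l0 < 0 -> 0 < l1 ->
  2 <= bound_term l0 l1 * (1 - ((l0 + l1) / (l1 - l0)) ^ 2).
Proof.
  intros H0 H1. unfold bound_term.
  assert (Ek : 1 - ((l0 + l1) / (l1 - l0)) ^ 2 = - 4 * l0 * l1 / (l1 - l0) ^ 2)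
    by (field; lra).
  rewrite Ek.
  assert (Hs : 0 < (l1 - l0) ^ 2) by nra.
  assert (Hk : 0 <= - 4 * l0 * l1 / (l1 - l0) ^ 2) by (apply Rle_div_r; nra).
  destruct (Rle_or_lt (- l0) l1) as [Hc | Hc].
  - apply Rle_trans with
      ((2 * l1 - 4 * l0) / (- 3 * l0) * (- 4 * l0 * l1 / (l1 - l0) ^ 2));
      [| apply Rmult_le_compat_r; [exact Hk | apply Rmax_l]].
    replace ((2 * l1 - 4 * l0) / (- 3 * l0) * (- 4 * l0 * l1 / (l1 - l0) ^ 2))
      with (8 * l1 * (l1 - 2 * l0) / (3 * (l1 - l0) ^ 2)) by (field; lra).
    apply Rle_div_r; nra.
  - apply Rle_trans with
      ((4 * l1 - 2 * l0) / (3 * l1) * (- 4 * l0 * l1 / (l1 - l0) ^ 2));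
      [| apply Rmult_le_compat_r; [exact Hk | apply Rmax_r]].
    replace ((4 * l1 - 2 * l0) / (3 * l1) * (- 4 * l0 * l1 / (l1 - l0) ^ 2))
      with (- 8 * l0 * (2 * l1 - l0) / (3 * (l1 - l0) ^ 2)) by (field; lra).
    apply Rle_div_r; nra.
Qed.

Lemma bound_term_ge_2 (l0 l1 : R) : l0 < 0 -> 0 < l1 -> 2 <= bound_term l0 l1.
Proof.
  intros H0 H1.
  assert (H := bound_term_ge l0 l1 H0 H1).
  assert (Hk : 0 <= 1 - ((l0 + l1) / (l1 - l0)) ^ 2).
  { replace (1 - ((l0 + l1) / (l1 - l0)) ^ 2) with (- 4 * l0 * l1 / (l1 - l0) ^ 2)
      by (field; lra).
    apply Rle_div_r; nra. }
  assert (Hk2 := pow2_ge_0 ((l0 + l1) / (l1 - l0))).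
  destruct (Rle_or_lt 0 (bound_term l0 l1)); nra.
Qed.

(** Reflecting the line negates and swaps the exponents, which only exchanges the two entries of the
    maximum. Hence one constant serves for both halves of a hat. *)
Lemma bound_term_reflect (l0 l1 : R) :
  l0 <> 0 -> l1 <> 0 -> bound_term (- l1) (- l0) = bound_term l0 l1.
Proof.
  intros H0 H1. unfold bound_term. rewrite Rmax_comm.
  f_equal; field; lra.
Qed.

(* [E] stands for the integral of [exp ((l0 + l1) u)] over [[0, h]]; the two equations
   determine it also when [l0 + l1 = 0]. *)
Lemma exp_integral_bound (l0 l1 h E : R) :
  l0 < 0 -> 0 < l1 -> 0 < h ->
  (l0 + l1) * E = exp ((l0 + l1) * h) - 1 -> (l0 + l1 = 0 -> E = h) ->
  let y := (l1 - l0) * h / 2 in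
  let k := (l0 + l1) / (l1 - l0) in
  (l1 - l0) * E <= 2 * exp (k * y) * (y + k ^ 2 * (sinh y - y)).
Proof.
  intros H0 H1 Hh HE HE0 y k.
  assert (Hy : 0 < y) by (unfold y; nra).
  assert (Hky : k * y = (l0 + l1) * h / 2) by (unfold k, y; field; lra).
  assert (Hk : -1 < k < 1).
  { unfold k; split; [apply Rlt_div_r | apply Rlt_div_l]; lra. }
  destruct (Req_dec (l0 + l1) 0) as [Hs | Hs].
  - assert (k = 0) by (unfold k; rewrite Hs; field; lra).
    rewrite H, Rmult_0_l, exp_0, (HE0 Hs). unfold y. simpl. lra.
  - assert (Hg := exp_pos (k * y)). set (g := exp (k * y)) in *.
    assert (Egm : g * exp (- (k * y)) = 1)
      by (unfold g; rewrite <- exp_plus, Rplus_opp_r; apply exp_0).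
    assert (Eg2 : exp ((l0 + l1) * h) = g * g)
      by (unfold g; rewrite <- exp_plus; f_equal; lra).
    rewrite Eg2 in HE.
    (* Thus [(l1 - l0) E] is [2 g sinh (k y) / k], to which the chord bound applies. That bound is
       stated for [k >= 0]; for negative [k] it is used at [-k], since [sinh] is odd. *)
    assert (HkE : k * ((l1 - l0) * E) = 2 * g * sinh (k * y)).
    { replace (k * ((l1 - l0) * E)) with ((l0 + l1) * E) by (unfold k; field; lra).
      rewrite HE. unfold sinh. fold g.
      replace (2 * g * ((g - exp (- (k * y))) / 2)) with (g * g - g * exp (- (k * y))) by field.
      lra. }
    assert (Hkn : k <> 0).
    { unfold k. intros Hk0. apply Hs.
      replace (l0 + l1) with ((l0 + l1) / (l1 - l0) * (l1 - l0)) by (field; lra).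
      rewrite Hk0; ring. }
    destruct (Rtotal_order k 0) as [Hn | [Hn | Hn]]; [| easy |].
    + assert (Hc := sinh_scal_chord (- k) y ltac:(lra) ltac:(lra)).
      replace (- k * y) with (- (k * y)) in Hc by ring.
      rewrite sinh_odd in Hc.
      apply Rmult_le_reg_l with (- k); [lra|].
      replace ((- k) ^ 2) with (k ^ 2) in Hc by ring.
      replace (- k * ((l1 - l0) * E)) with (2 * g * (- sinh (k * y))) by lra.
      replace (- k * (2 * g * (y + k ^ 2 * (sinh y - y))))
        with (2 * g * (- k * (y + k ^ 2 * (sinh y - y)))) by ring.
      apply Rmult_le_compat_l; lra.
    + assert (Hc := sinh_scal_chord k y ltac:(lra) ltac:(lra)).
      apply Rmult_le_reg_l with k; [lra|].
      rewrite HkE.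
      replace (k * (2 * g * (y + k ^ 2 * (sinh y - y))))
        with (2 * g * (k * (y + k ^ 2 * (sinh y - y)))) by ring.
      apply Rmult_le_compat_l; lra.
Qed.

(** The quotients are the integrals of [p], [p^2] and [p q]. With [e1 = g exp y] and
    [e0 = g exp (- y)], both sides turn out to be the positive factor [(l1 - l0) / (- l0 l1 N^2)],
    [N = e1 - e0], times the two sides of [Hmain]. *)
Lemma closed_form_inequality (l0 l1 h E : R) :
  l0 < 0 -> 0 < l1 -> 0 < h ->
  (l0 + l1) * E = exp ((l0 + l1) * h) - 1 -> (l0 + l1 = 0 -> E = h) ->
  let e1 := exp (l1 * h) in
  let e0 := exp (l0 * h) in
  ((e1 - 1) / l1 - (e0 - 1) / l0) / (e1 - e0) <=
  2 * bound_term l0 l1 *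
  (((e1 ^ 2 - 1) / (2 * l1) + (e0 ^ 2 - 1) / (2 * l0) - 2 * E) / (e1 - e0) ^ 2 -
   ((e1 + e0) * E - e0 * (e1 ^ 2 - 1) / (2 * l1) - e1 * (e0 ^ 2 - 1) / (2 * l0))
     / (e1 - e0) ^ 2).
Proof.
  intros H0 H1 Hh HE HE0 e1 e0.
  set (y := (l1 - l0) * h / 2). set (k := (l0 + l1) / (l1 - l0)).
  assert (Hw := exp_integral_bound l0 l1 h E H0 H1 Hh HE HE0).
  cbv zeta in Hw. fold y k in Hw.
  assert (Hy : 0 < y) by (unfold y; nra).
  assert (Hk : -1 < k < 1).
  { unfold k; split; [apply Rlt_div_r | apply Rlt_div_l]; lra. }
  assert (Hkey := exp_cosh_sinh_key k y ltac:(lra) Hy).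
  assert (HB := bound_term_ge l0 l1 H0 H1). fold k in HB.
  set (B := bound_term l0 l1) in *.
  assert (HB2 : 2 <= B) by (apply bound_term_ge_2; assumption).
  assert (Hg := exp_pos (k * y)). set (g := exp (k * y)) in *.
  assert (E1 : e1 = g * exp y).
  { unfold e1, g. rewrite <- exp_plus. f_equal. unfold k, y. field. lra. }
  assert (E0 : e0 = g * exp (- y)).
  { unfold e0, g. rewrite <- exp_plus. f_equal. unfold k, y. field. lra. }
  assert (EN : e1 - e0 = 2 * g * sinh y) by (rewrite E1, E0; unfold sinh; field).
  set (A := g * (cosh y - k * sinh y)) in *.
  assert (EA : A = (l1 * e0 - l0 * e1) / (l1 - l0)).
  { unfold A. rewrite E1, E0. unfold cosh, sinh, k. field. lra. }
  assert (Hsy := sinh_ge_id y ltac:(lra)).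
  assert (HN : 0 < e1 - e0) by (rewrite EN; nra).
  assert (HE' : (l0 + l1) * E = e1 * e0 - 1).
  { rewrite HE. unfold e1, e0. rewrite <- exp_plus. f_equal. f_equal. ring. }
  assert (He0 : 0 < e0) by apply exp_pos.
  assert (He1 : 0 < e1) by apply exp_pos.
  assert (HA : 0 < A).
  { rewrite EA. apply Rdiv_lt_0_compat; nra. }
  (* This is [A - 1 <= B (1 - w) (A + 1)] multiplied by [e1 - e0], since
     [(e1 - e0) w = (l1 - l0) E]. *)
  assert (Hmain : (e1 - e0) * (A - 1) <= B * ((e1 - e0) - (l1 - l0) * E) * (A + 1)).
  { apply Rle_trans with (2 * g * (2 * (sinh y - y) * (A + 1))).
    { rewrite EN, Rmult_assoc. apply Rmult_le_compat_l; lra. }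
    apply Rle_trans with (B * (2 * g * ((1 - k ^ 2) * (sinh y - y))) * (A + 1)).
    - replace (B * (2 * g * ((1 - k ^ 2) * (sinh y - y))) * (A + 1))
        with (2 * g * ((B * (1 - k ^ 2)) * (sinh y - y) * (A + 1))) by ring.
      apply Rmult_le_compat_l; [lra|].
      apply Rmult_le_compat_r; [lra|].
      apply Rmult_le_compat_r; lra.
    - apply Rmult_le_compat_r; [lra|].
      apply Rmult_le_compat_l; [lra|].
      rewrite EN. lra. }
  set (N := e1 - e0) in *.
  assert (EI : ((e1 - 1) / l1 - (e0 - 1) / l0) / N
               = (l1 - l0) / (- l0 * l1 * N ^ 2) * (N * (A - 1))).
  { rewrite EA. field. lra. }
  assert (ED : ((e1 ^ 2 - 1) / (2 * l1) + (e0 ^ 2 - 1) / (2 * l0) - 2 * E) / N ^ 2 -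
               ((e1 + e0) * E - e0 * (e1 ^ 2 - 1) / (2 * l1) - e1 * (e0 ^ 2 - 1) / (2 * l0))
                 / N ^ 2
               = (l1 - l0) / (- l0 * l1 * N ^ 2) * ((N - (l1 - l0) * E) * (A + 1) / 2)).
  { rewrite EA. apply Rminus_diag_uniq.
    (* The two sides agree only modulo the relation [(l0 + l1) E = e1 e0 - 1]; the expression below
       exhibits their difference as an explicit multiple of it. *)
    match goal with |- ?L - ?R = 0 =>
      replace (L - R) with
        (((l0 + l1) * E - (e1 * e0 - 1)) * (l1 * (1 + e0) + l0 * (1 + e1))
           / (- 2 * l0 * l1 * N ^ 2))
    end.
    - rewrite HE'. field. lra.
    - unfold N. field. fold N. lra. }
  rewrite EI, ED.
  replace (2 * B * ((l1 - l0) / (- l0 * l1 * N ^ 2) * ((N - (l1 - l0) * E) * (A + 1) / 2)))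
    with ((l1 - l0) / (- l0 * l1 * N ^ 2) * (B * (N - (l1 - l0) * E) * (A + 1)))
    by (field; lra).
  apply Rmult_le_compat_l; [| exact Hmain].
  left. apply Rdiv_lt_0_compat; [lra|].
  apply Rmult_lt_0_compat; nra.
Qed.

(** * The two halves of a hat: reflection, positivity, sum and integrals *)

Definition rise (l0 l1 a b x : R) : R := Phi l0 l1 (x - a) / Phi l0 l1 (b - a).
Definition fall (l0 l1 a b x : R) : R := Phi l0 l1 (x - b) / Phi l0 l1 (a - b).

Lemma Phi_opp (l0 l1 x : R) : Phi l0 l1 (- x) = - Phi (- l1) (- l0) x.
Proof.
  unfold Phi.
  replace (l1 * - x) with (- l1 * x) by ring.
  replace (l0 * - x) with (- l0 * x) by ring.
  replace (- l0 - - l1) with (l1 - l0) by ring.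
  unfold Rdiv. ring.
Qed.

Lemma fall_opp (l0 l1 a b x : R) :
  Phi (- l1) (- l0) (b - a) <> 0 ->
  fall l0 l1 a b (- x) = rise (- l1) (- l0) (- b) (- a) x.
Proof.
  intros Hn. unfold fall, rise.
  replace (- x - b) with (- (x - - b)) by ring.
  replace (a - b) with (- (b - a)) by ring.
  replace (- a - - b) with (b - a) by ring.
  rewrite !Phi_opp. field. exact Hn.
Qed.

Lemma Phi_pos (l0 l1 x : R) : l0 < l1 -> 0 < x -> 0 < Phi l0 l1 x.
Proof.
  intros Hl Hx. unfold Phi. apply Rdiv_lt_0_compat; [| lra].
  enough (exp (l0 * x) < exp (l1 * x)) by lra. apply exp_increasing; nra.
Qed.

Lemma rise_exp (l0 l1 a b x : R) :
  l0 < l1 -> a < b ->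
  rise l0 l1 a b x =
  (exp (l1 * (x - a)) - exp (l0 * (x - a))) / (exp (l1 * (b - a)) - exp (l0 * (b - a))).
Proof.
  intros Hl Hab. assert (Hp := Phi_pos l0 l1 (b - a) Hl ltac:(lra)).
  unfold rise, Phi in *. field. split; [| lra].
  intros Hc. rewrite Hc in Hp. unfold Rdiv in Hp. lra.
Qed.

(** Expanding from the left endpoint [a], as in [rise_exp], gives both halves the same denominator
    and leaves only exponentials in [x - a]. *)
Lemma fall_exp (l0 l1 a b x : R) :
  l0 < l1 -> a < b ->
  fall l0 l1 a b x =
  (exp (l1 * (b - a)) * exp (l0 * (x - a)) - exp (l0 * (b - a)) * exp (l1 * (x - a)))
  / (exp (l1 * (b - a)) - exp (l0 * (b - a))).
Proof.
  intros Hl Hab.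
  assert (Hd : exp (l0 * (b - a)) < exp (l1 * (b - a))) by (apply exp_increasing; nra).
  unfold fall, Phi.
  replace (x - b) with ((x - a) - (b - a)) by ring.
  replace (a - b) with (- (b - a)) by ring.
  set (h := b - a) in *. set (u := x - a).
  rewrite !Rmult_minus_distr_l. unfold Rminus. rewrite !exp_plus.
  rewrite !Ropp_mult_distr_r_reverse, !exp_Ropp.
  assert (H1 := exp_pos (l1 * h)). assert (H0 := exp_pos (l0 * h)).
  field. repeat split; lra.
Qed.

Lemma rise_nonneg (l0 l1 a b x : R) :
  l0 < l1 -> a < b -> a <= x -> 0 <= rise l0 l1 a b x.
Proof.
  intros Hl Hab [Hx | <-]; unfold rise.
  - left. apply Rdiv_lt_0_compat; apply Phi_pos; lra.
  - unfold Phi at 1. rewrite Rminus_diag, !Rmult_0_r, exp_0. unfold Rdiv. lra.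
Qed.

Lemma fall_nonneg (l0 l1 a b x : R) :
  l0 < l1 -> a < b -> x <= b -> 0 <= fall l0 l1 a b x.
Proof.
  intros Hl Hab Hx. rewrite <- (Ropp_involutive x), fall_opp.
  - apply rise_nonneg; lra.
  - apply Rgt_not_eq, Phi_pos; lra.
Qed.

Lemma rise_left (l0 l1 a b : R) : rise l0 l1 a b a = 0.
Proof. unfold rise, Phi. rewrite Rminus_diag, !Rmult_0_r, exp_0. unfold Rdiv. ring. Qed.

Lemma fall_right (l0 l1 a b : R) : fall l0 l1 a b b = 0.
Proof. unfold fall, Phi. rewrite Rminus_diag, !Rmult_0_r, exp_0. unfold Rdiv. ring. Qed.

Lemma rise_right (l0 l1 a b : R) : l0 < l1 -> a < b -> rise l0 l1 a b b = 1.
Proof. intros Hl Hab. assert (H := Phi_pos l0 l1 (b - a) Hl). unfold rise. field. lra. Qed.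

Lemma fall_left (l0 l1 a b : R) : l0 < l1 -> a < b -> fall l0 l1 a b a = 1.
Proof.
  intros Hl Hab. rewrite <- (Ropp_involutive a) at 2. rewrite fall_opp.
  - apply rise_right; lra.
  - apply Rgt_not_eq, Phi_pos; lra.
Qed.

(** With [e_i = exp (l_i h)] and [u = x - a], the sum is [((1 - e0) exp (l1 u) + (e1 - 1) exp (l0
    u)) / (e1 - e0)]. The sign condition makes both coefficients positive, and after bounding each
    exponential by its chord the terms in [u / h] cancel. *)
Lemma rise_add_fall_le_1 (l0 l1 a b x : R) :
  l0 < 0 -> 0 < l1 -> a < b -> a <= x <= b ->
  rise l0 l1 a b x + fall l0 l1 a b x <= 1.
Proof.
  intros H0 H1 Hab Hx.
  rewrite rise_exp, fall_exp by lra.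
  set (h := b - a). set (u := x - a).
  assert (C1 := exp_chord l1 h u ltac:(unfold h; lra) ltac:(unfold h, u; lra)).
  assert (C0 := exp_chord l0 h u ltac:(unfold h; lra) ltac:(unfold h, u; lra)).
  assert (L1 : 1 < exp (l1 * h)) by (rewrite <- exp_0; apply exp_increasing; unfold h; nra).
  assert (L0 : exp (l0 * h) < 1) by (rewrite <- exp_0; apply exp_increasing; unfold h; nra).
  rewrite <- Rdiv_plus_distr. apply Rle_div_l; [lra|].
  assert ((1 - exp (l0 * h)) * exp (l1 * u) <=
          (1 - exp (l0 * h)) * (1 + (exp (l1 * h) - 1) * (u / h)))
    by (apply Rmult_le_compat_l; lra).
  assert ((exp (l1 * h) - 1) * exp (l0 * u) <=
          (exp (l1 * h) - 1) * (1 + (exp (l0 * h) - 1) * (u / h)))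
    by (apply Rmult_le_compat_l; lra).
  nra.
Qed.

Lemma rise_continuous (l0 l1 a b x : R) : continuous (rise l0 l1 a b) x.
Proof. apply (ex_derive_continuous (rise l0 l1 a b)). unfold rise, Phi, Rdiv. auto_derive. easy. Qed.

Lemma fall_continuous (l0 l1 a b x : R) : continuous (fall l0 l1 a b) x.
Proof. apply (ex_derive_continuous (fall l0 l1 a b)). unfold fall, Phi, Rdiv. auto_derive. easy. Qed.

Lemma ex_RInt_of_continuous (f : R -> R) (a b : R) :
  (forall x, continuous f x) -> ex_RInt f a b.
Proof. intros Hf. apply (ex_RInt_continuous (V := R_CompleteNormedModule)). auto. Qed.

Lemma is_RInt_exp (l a b : R) :
  l <> 0 -> is_RInt (fun x => exp (l * (x - a))) a b ((exp (l * (b - a)) - 1) / l).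
Proof.
  intros Hl.
  replace ((exp (l * (b - a)) - 1) / l)
    with (minus (exp (l * (b - a)) / l) (exp (l * (a - a)) / l) : R).
  - apply (is_RInt_derive (fun x => exp (l * (x - a)) / l)).
    + intros x _. auto_derive; [easy | unfold Rminus; field; assumption].
    + intros x _. apply (ex_derive_continuous (fun x => exp (l * (x - a)))).
      auto_derive. easy.
  - unfold minus, plus, opp; simpl. rewrite Rminus_diag, Rmult_0_r, exp_0. field. assumption.
Qed.

Lemma ex_integral_exp (s a b : R) :
  exists E, is_RInt (fun x => exp (s * (x - a))) a b E /\
    s * E = exp (s * (b - a)) - 1 /\ (s = 0 -> E = b - a).
Proof.
  destruct (Req_dec s 0) as [-> | Hs].
  - exists (b - a). split; [| split; [rewrite !Rmult_0_l, exp_0; ring | easy]].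
    apply (is_RInt_ext (fun _ => 1)).
    + intros x _. rewrite Rmult_0_l, exp_0. easy.
    + replace (b - a) with (scal (b - a) 1 : R) by (unfold scal; simpl; unfold mult; simpl; ring).
      apply (is_RInt_const (V := R_NormedModule)).
  - exists ((exp (s * (b - a)) - 1) / s). split; [now apply is_RInt_exp | split].
    + field. assumption.
    + easy.
Qed.

Lemma is_RInt_lin3 (f1 f2 f3 : R -> R) (a b c1 c2 c3 I1 I2 I3 : R) :
  is_RInt f1 a b I1 -> is_RInt f2 a b I2 -> is_RInt f3 a b I3 ->
  is_RInt (fun x => c1 * f1 x + c2 * f2 x + c3 * f3 x) a b (c1 * I1 + c2 * I2 + c3 * I3).
Proof.
  intros H1 H2 H3.
  apply (is_RInt_plus (V := R_NormedModule)); [apply (is_RInt_plus (V := R_NormedModule)) |];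
    now apply (is_RInt_scal (V := R_NormedModule)).
Qed.

Lemma rise_integral_bound (l0 l1 a b : R) :
  l0 < 0 -> 0 < l1 -> a < b ->
  RInt (rise l0 l1 a b) a b <=
  2 * bound_term l0 l1 *
  (RInt (fun x => rise l0 l1 a b x * rise l0 l1 a b x) a b -
   RInt (fun x => rise l0 l1 a b x * fall l0 l1 a b x) a b).
Proof.
  intros H0 H1 Hab.
  destruct (ex_integral_exp (l0 + l1) a b) as [E [HI [HE HE0]]].
  assert (Hc := closed_form_inequality l0 l1 (b - a) E H0 H1 ltac:(lra) HE HE0).
  cbv zeta in Hc.
  assert (HN : exp (l0 * (b - a)) < exp (l1 * (b - a))) by (apply exp_increasing; nra).
  assert (I1 := is_RInt_exp l1 a b ltac:(lra)).
  assert (I0 := is_RInt_exp l0 a b ltac:(lra)).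
  assert (I11 := is_RInt_exp (2 * l1) a b ltac:(lra)).
  assert (I00 := is_RInt_exp (2 * l0) a b ltac:(lra)).
  assert (Esq : forall l u, exp (2 * l * u) = exp (l * u) ^ 2).
  { intros l u. replace (2 * l * u) with (l * u + l * u) by ring.
    rewrite exp_plus. ring. }
  assert (Es : forall u, exp ((l0 + l1) * u) = exp (l0 * u) * exp (l1 * u)).
  { intros u. rewrite <- exp_plus. f_equal. ring. }
  rewrite Esq in I11, I00.
  set (e1 := exp (l1 * (b - a))) in *. set (e0 := exp (l0 * (b - a))) in *.
  set (N := e1 - e0) in *.
  assert (HN' : N <> 0) by (unfold N; lra).
  (* All three integrands are combinations of at most three exponentials. Here only two occur, so
     the third coefficient is [0]; the two products use the exponents [2 l1], [2 l0] and
     [l0 + l1]. *)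
  erewrite (is_RInt_unique (rise l0 l1 a b));
    [| eapply is_RInt_ext; [| exact (is_RInt_lin3 _ _ _ a b (/ N) (- / N) 0 _ _ _ I1 I0 I0)]].
  2: { intros x _. cbv beta. rewrite rise_exp by lra. fold e1 e0 N.
       match goal with |- ?u = ?v => change (@eq R u v) end. field. assumption. }
  erewrite (is_RInt_unique (fun x => rise l0 l1 a b x * rise l0 l1 a b x));
    [| eapply is_RInt_ext;
       [| exact (is_RInt_lin3 _ _ _ a b (/ N ^ 2) (/ N ^ 2) (- 2 / N ^ 2) _ _ _ I11 I00 HI)]].
  2: { intros x _. cbv beta. rewrite rise_exp by lra. fold e1 e0 N. rewrite !Esq, Es.
       match goal with |- ?u = ?v => change (@eq R u v) end. field. assumption. }
  erewrite (is_RInt_unique (fun x => rise l0 l1 a b x * fall l0 l1 a b x));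
    [| eapply is_RInt_ext;
       [| exact (is_RInt_lin3 _ _ _ a b (- e0 / N ^ 2) (- e1 / N ^ 2) ((e1 + e0) / N ^ 2)
                   _ _ _ I11 I00 HI)]].
  2: { intros x _. cbv beta. rewrite rise_exp, fall_exp by lra. fold e1 e0 N. rewrite !Esq, Es.
       match goal with |- ?u = ?v => change (@eq R u v) end. field. assumption. }
  refine (Rle_trans _ _ _ (Req_le _ _ _) (Rle_trans _ _ _ Hc (Req_le _ _ _))).
  - field. lra.
  - field. lra.
Qed.

(** Under [x -> - x] the interval becomes [[-b, -a]], the two halves trade places with exponents
    [- l1] and [- l0], and [bound_term] is unchanged, so [rise_integral_bound] applies. *)
Lemma fall_integral_bound (l0 l1 a b : R) :
  l0 < 0 -> 0 < l1 -> a < b ->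
  RInt (fall l0 l1 a b) a b <=
  2 * bound_term l0 l1 *
  (RInt (fun x => fall l0 l1 a b x * fall l0 l1 a b x) a b -
   RInt (fun x => rise l0 l1 a b x * fall l0 l1 a b x) a b).
Proof.
  intros H0 H1 Hab.
  assert (Hn : Phi (- l1) (- l0) (b - a) <> 0) by (apply Rgt_not_eq, Phi_pos; lra).
  assert (Hn' : Phi l0 l1 (- a - - b) <> 0) by (apply Rgt_not_eq, Phi_pos; lra).
  assert (Hr : forall x, rise l0 l1 a b (- x) = fall (- l1) (- l0) (- b) (- a) x).
  { intros x.
    assert (H := fall_opp (- l1) (- l0) (- b) (- a) (- x)).
    rewrite !Ropp_involutive in H. now rewrite H. }
  assert (Hrefl : forall f g : R -> R, (forall x, continuous f x) ->
            (forall x, f (- x) = g x) -> RInt f a b = RInt g (- b) (- a)).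
  { intros f g Hf Hfg.
    assert (H := RInt_comp_lin (V := R_CompleteNormedModule) f (-1) 0 (- b) (- a)).
    replace (-1 * - b + 0) with b in H by ring. replace (-1 * - a + 0) with a in H by ring.
    specialize (H (ex_RInt_of_continuous f _ _ Hf)).
    rewrite <- (opp_RInt_swap (V := R_CompleteNormedModule)) by now apply ex_RInt_of_continuous.
    rewrite <- H.
    rewrite (RInt_ext _ (fun y => scal (-1) (g y))).
    - rewrite (RInt_scal (V := R_CompleteNormedModule)).
      + unfold scal, opp; simpl. unfold mult; simpl. ring.
      + apply (ex_RInt_ext (fun x => f (- x))).
        * intros x _. apply Hfg.
        * apply ex_RInt_of_continuous. intros x.
          apply (continuous_comp Ropp f); [| apply Hf].
          apply (continuous_opp (V := R_NormedModule)), continuous_id.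
    - intros x _. rewrite <- Hfg. do 2 f_equal. ring. }
  rewrite (Hrefl _ (rise (- l1) (- l0) (- b) (- a)) (fall_continuous l0 l1 a b)).
  2: { intros x. now apply fall_opp. }
  rewrite (Hrefl (fun x => fall l0 l1 a b x * fall l0 l1 a b x)
             (fun x => rise (- l1) (- l0) (- b) (- a) x * rise (- l1) (- l0) (- b) (- a) x)).
  2: { intros x. apply (continuous_mult (K := R_AbsRing)); apply fall_continuous. }
  2: { intros x. now rewrite fall_opp. }
  rewrite (Hrefl (fun x => rise l0 l1 a b x * fall l0 l1 a b x)
             (fun x => rise (- l1) (- l0) (- b) (- a) x * fall (- l1) (- l0) (- b) (- a) x)).
  2: { intros x. apply (continuous_mult (K := R_AbsRing));
       [apply rise_continuous | apply fall_continuous]. }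
  2: { intros x. rewrite fall_opp, Hr by assumption. ring. }
  rewrite <- (bound_term_reflect l0 l1) by lra.
  apply rise_integral_bound; lra.
Qed.

(** * From knot intervals to the whole mesh *)

(** Hats are given by cases and jump at the two end knots. On each closed knot interval they are
    exchanged for globally continuous functions, for which integrability is immediate. *)
Lemma RInt_eq_continuous (F G : R -> R) (a b : R) :
  a <= b -> (forall x, continuous G x) -> (forall x, a <= x <= b -> F x = G x) ->
  ex_RInt F a b /\ RInt F a b = RInt G a b.
Proof.
  intros Hab HG HFG. split.
  - apply (ex_RInt_ext G).
    + rewrite Rmin_left, Rmax_right by lra. intros x Hx. symmetry. apply HFG. lra.
    + now apply ex_RInt_of_continuous.
  - apply RInt_ext. rewrite Rmin_left, Rmax_right by lra. intros x Hx. apply HFG. lra.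
Qed.

(** The extension is constant beyond the endpoints: [f] is composed with the 1-Lipschitz retraction
    of the line onto [[a, b]]. *)
Lemma continuous_on_extend (f : R -> R) (a b : R) :
  a <= b -> continuous_on (in_cc a b) f ->
  exists ft : R -> R, (forall x, continuous ft x) /\ (forall x, in_cc a b x -> ft x = f x).
Proof.
  intros Hab Hf.
  set (clamp := fun x => Rmax a (Rmin x b)).
  assert (Hin : forall x, in_cc a b (clamp x)).
  { intros x. unfold clamp, in_cc. split; [apply Rmax_l|].
    apply Rmax_lub; [lra | apply Rmin_r]. }
  assert (Hlip : forall x z, Rabs (clamp z - clamp x) <= Rabs (z - x)).
  { intros x z. unfold clamp, Rmax, Rmin.
    repeat destruct Rle_dec; unfold Rabs; repeat destruct Rcase_abs; lra. }
  exists (fun x => f (clamp x)). split.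
  - intros x. unfold continuous.
    apply (filterlim_comp _ _ _ clamp f (locally x) (within (in_cc a b) (locally (clamp x)))).
    + intros P [eps HP]. exists eps. intros z Hz. apply HP; [| apply Hin].
      apply Rle_lt_trans with (2 := Hz). apply Hlip.
    + apply Hf, Hin.
  - intros x [Hx1 Hx2]. f_equal. unfold clamp. rewrite Rmin_left, Rmax_right; lra.
Qed.

Lemma RInt_mult_l (k : R) (f : R -> R) (a b : R) :
  ex_RInt f a b -> RInt (fun x => k * f x) a b = k * RInt f a b.
Proof. exact (RInt_scal (V := R_CompleteNormedModule) f a b k). Qed.

Lemma max_abs_index (n : nat) (c : nat -> R) :
  (1 <= n)%nat ->
  exists m, (1 <= m <= n)%nat /\ forall i, (1 <= i <= n)%nat -> Rabs (c i) <= Rabs (c m).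
Proof.
  induction n as [|n IH]; [lia|]. intros _.
  destruct (Nat.eq_dec n 0) as [-> | Hn].
  - exists 1%nat. split; [lia|]. intros i Hi. replace i with 1%nat by lia. lra.
  - destruct (IH ltac:(lia)) as [m [Hm Hmax]].
    destruct (Rle_or_lt (Rabs (c (S n))) (Rabs (c m))) as [Hc | Hc].
    + exists m. split; [lia|]. intros i Hi.
      destruct (Nat.eq_dec i (S n)) as [-> | Hi']; [exact Hc | apply Hmax; lia].
    + exists (S n). split; [lia|]. intros i Hi.
      destruct (Nat.eq_dec i (S n)) as [-> | Hi']; [lra |].
      assert (H := Hmax i ltac:(lia)). lra.
Qed.

Lemma bound_term_le_max (n j : nat) (lam0 lam1 : nat -> R) :
  (1 <= j < n)%nat -> bound_term (lam0 j) (lam1 j) <= max_bound n lam0 lam1.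
Proof.
  intros Hj. unfold max_bound.
  assert (Hin : In j (seq 1 (n - 1))) by (apply in_seq; lia).
  induction (seq 1 (n - 1)) as [|i l IH]; [easy|]. simpl.
  destruct Hin as [-> | Hin]; [apply Rmax_l|].
  apply Rle_trans with (1 := IH Hin), Rmax_r.
Qed.

(** * Meshes, and hats restricted to knot intervals *)

Definition mesh (n : nat) (t : nat -> R) : Prop :=
  forall i : nat, (1 <= i)%nat -> (i < n)%nat -> t i < t (S i).

Lemma mesh_le (n : nat) (t : nat -> R) (i k : nat) :
  mesh n t -> (1 <= i <= k)%nat -> (k <= n)%nat -> t i <= t k.
Proof.
  intros Ht [Hi Hik]. induction Hik as [|k Hik IH]; intros Hk; [lra|].
  assert (H := Ht k ltac:(lia) ltac:(lia)). specialize (IH ltac:(lia)). lra.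
Qed.

Lemma mesh_piece (n : nat) (t : nat -> R) (x : R) :
  (2 <= n)%nat -> t 1%nat <= x <= t n ->
  exists j, (1 <= j < n)%nat /\ t j <= x <= t (S j).
Proof.
  intros Hn. induction Hn as [|n Hn IH]; intros Hx.
  - exists 1%nat. split; [lia | exact Hx].
  - destruct (Rle_or_lt x (t n)) as [Hc | Hc].
    + destruct (IH ltac:(lra)) as [j [Hj Hxj]]. exists j. split; [lia | exact Hxj].
    + exists n. split; [lia | lra].
Qed.

Lemma ex_RInt_mesh (n : nat) (t : nat -> R) (F : R -> R) :
  (forall j, (1 <= j < n)%nat -> ex_RInt F (t j) (t (S j))) ->
  (1 <= n)%nat -> ex_RInt F (t 1%nat) (t n).
Proof.
  intros HF Hn. induction Hn as [|n Hn IH].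
  - apply ex_RInt_point.
  - apply (ex_RInt_Chasles (V := R_NormedModule)) with (t n).
    + apply IH. intros j Hj. apply HF. lia.
    + apply HF. lia.
Qed.

(** This carries local inequalities over to the whole interval; on a single piece at most two hats
    are nonzero. *)
Lemma RInt_mesh_le (n : nat) (t : nat -> R) (F G : R -> R) :
  (forall j, (1 <= j < n)%nat -> ex_RInt F (t j) (t (S j))) ->
  (forall j, (1 <= j < n)%nat -> ex_RInt G (t j) (t (S j))) ->
  (forall j, (1 <= j < n)%nat -> RInt F (t j) (t (S j)) <= RInt G (t j) (t (S j))) ->
  (1 <= n)%nat -> RInt F (t 1%nat) (t n) <= RInt G (t 1%nat) (t n).
Proof.
  intros HF HG HFG Hn. induction Hn as [|n Hn IH].
  - rewrite !RInt_point. lra.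
  - rewrite <- (RInt_Chasles F _ (t n)), <- (RInt_Chasles G _ (t n)).
    + apply Rplus_le_compat.
      * apply IH; intros j Hj; [apply HF | apply HG | apply HFG]; lia.
      * apply HFG. lia.
    + apply ex_RInt_mesh; [| exact Hn]. intros j Hj. apply HG. lia.
    + apply HG. lia.
    + apply ex_RInt_mesh; [| exact Hn]. intros j Hj. apply HF. lia.
    + apply HF. lia.
Qed.

(* The restriction of [H_i] to [[t_j, t_(j+1)]], extended to a continuous function on the line. *)
Definition piece (t lam0 lam1 : nat -> R) (j i : nat) : R -> R :=
  if Nat.eqb i j then fall (lam0 j) (lam1 j) (t j) (t (S j))
  else if Nat.eqb i (S j) then rise (lam0 j) (lam1 j) (t j) (t (S j))
  else fun _ => 0.

Definition sign_cond (n : nat) (lam0 lam1 : nat -> R) : Prop :=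
  forall j : nat, (1 <= j)%nat -> (j <= n - 1)%nat -> lam0 j < 0 /\ 0 < lam1 j.

Lemma piece_continuous (t lam0 lam1 : nat -> R) (j i : nat) (x : R) :
  continuous (piece t lam0 lam1 j i) x.
Proof.
  unfold piece. destruct Nat.eqb; [apply fall_continuous|].
  destruct Nat.eqb; [apply rise_continuous | apply continuous_const].
Qed.

Lemma piece_same (t lam0 lam1 : nat -> R) (j : nat) :
  piece t lam0 lam1 j j = fall (lam0 j) (lam1 j) (t j) (t (S j)).
Proof. unfold piece. now rewrite Nat.eqb_refl. Qed.

Lemma piece_succ (t lam0 lam1 : nat -> R) (j : nat) :
  piece t lam0 lam1 j (S j) = rise (lam0 j) (lam1 j) (t j) (t (S j)).
Proof.
  unfold piece. rewrite Nat.eqb_refl.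
  now rewrite (proj2 (Nat.eqb_neq (S j) j) ltac:(lia)).
Qed.

Lemma piece_other (t lam0 lam1 : nat -> R) (j i : nat) :
  i <> j -> i <> S j -> piece t lam0 lam1 j i = fun _ => 0.
Proof.
  intros H1 H2. unfold piece.
  rewrite (proj2 (Nat.eqb_neq i j) H1). now rewrite (proj2 (Nat.eqb_neq i (S j)) H2).
Qed.

(** The delicate points are the knots, where the case distinction in [hat] may select the formula of
    the neighbouring interval; there the competing values agree, being both [1] at the peak and both
    [0] at an end of the support. For [i = 0] and [i > n] both sides vanish, which [gram_dominance]
    uses in its first and last rows. *)
Lemma hat_eq_piece (n : nat) (t lam0 lam1 : nat -> R) (i j : nat) (x : R) :
  mesh n t -> sign_cond n lam0 lam1 ->
  (1 <= j < n)%nat -> t j <= x <= t (S j) ->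
  hat n t lam0 lam1 i x = piece t lam0 lam1 j i x.
Proof.
  intros Ht Hl Hj Hx.
  assert (Hpos : forall k, (1 <= k < n)%nat -> lam0 k < lam1 k).
  { intros k Hk. destruct (Hl k) as [? ?]; [lia | lia | lra]. }
  assert (Hfold : forall k y, phi lam0 lam1 k (y - t (S k)) / phi lam0 lam1 k (t k - t (S k))
                    = fall (lam0 k) (lam1 k) (t k) (t (S k)) y) by reflexivity.
  assert (Hrold : forall k y, phi lam0 lam1 k (y - t k) / phi lam0 lam1 k (t (S k) - t k)
                    = rise (lam0 k) (lam1 k) (t k) (t (S k)) y) by reflexivity.
  assert (Hzero : i <> j -> i <> S j -> piece t lam0 lam1 j i x = 0)
    by (intros; now rewrite piece_other).
  assert (Hmono : forall k l, (1 <= k <= l)%nat -> (l <= n)%nat -> t k <= t l)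
    by (intros; now apply mesh_le with n).
  assert (Hstrict := Ht j ltac:(lia) ltac:(lia)).
  unfold hat. cbv zeta.
  destruct (Nat.eqb_spec i 1) as [-> | Hi1].
  - change (t 2%nat) with (t (S 1)).
    destruct (Nat.eq_dec j 1) as [-> | Hj1].
    + rewrite piece_same. destruct Rle_dec; [| lra]. destruct Rle_dec; [| lra]. apply Hfold.
    + rewrite Hzero by lia.
      assert (H2 := Hmono 2%nat j ltac:(lia) ltac:(lia)).
      destruct Rle_dec; [| easy]. destruct Rle_dec; [| easy].
      replace x with (t 2%nat) by lra. rewrite Hfold. apply fall_right.
  - destruct (Nat.eqb_spec i n) as [-> | Hin].
    + assert (En : exists k, n = S k /\ (1 <= k)%nat) by (exists (n - 1)%nat; lia).
      destruct En as [k [-> Hk]].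
      replace (S k - 1)%nat with k by lia.
      destruct (Nat.eq_dec j k) as [-> | Hjk].
      * rewrite piece_succ. destruct Rle_dec; [| lra]. destruct Rle_dec; [| lra]. apply Hrold.
      * rewrite Hzero by lia.
        assert (H2 := Hmono (S j) k ltac:(lia) ltac:(lia)).
        destruct Rle_dec; [| easy]. destruct Rle_dec; [| easy].
        replace x with (t k) by lra. rewrite Hrold. apply rise_left.
    + destruct (Nat.leb_spec 2 i) as [Hi2 | Hi2]; simpl andb.
      2: { rewrite Hzero by lia. easy. }
      destruct (Nat.leb_spec i (n - 1)) as [Hi3 | Hi3].
      2: { rewrite Hzero by lia. easy. }
      destruct i as [|k]; [lia|].
      replace (S k - 1)%nat with k by lia. replace (S k + 1)%nat with (S (S k)) by lia.
      rewrite Hfold, Hrold.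
      assert (Hk := Ht k ltac:(lia) ltac:(lia)).
      assert (HSk := Ht (S k) ltac:(lia) ltac:(lia)).
      destruct (Nat.eq_dec j k) as [-> | Hjk].
      * rewrite piece_succ. destruct Rle_dec; [| lra]. destruct Rle_dec; [easy | lra].
      * destruct (Nat.eq_dec j (S k)) as [-> | HjSk].
        -- rewrite piece_same. destruct Rle_dec; [| lra]. destruct Rle_dec.
           ++ replace x with (t (S k)) by lra.
              rewrite rise_right, fall_left; [easy | | lra | | lra]; apply Hpos; lia.
           ++ destruct Rle_dec; [easy | lra].
        -- rewrite Hzero by lia.
           destruct (Nat.le_gt_cases j k) as [Hc | Hc].
           ++ assert (H2 := Hmono (S j) k ltac:(lia) ltac:(lia)).
              destruct Rle_dec; [| easy]. destruct Rle_dec; [| lra].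
              replace x with (t k) by lra. apply rise_left.
           ++ assert (H2 := Hmono (S (S k)) j ltac:(lia) ltac:(lia)).
              destruct Rle_dec; [| easy]. destruct Rle_dec; [lra |].
              destruct Rle_dec; [| easy].
              replace x with (t (S (S k))) by lra. apply fall_right.
Qed.

Lemma piece_nonneg (n : nat) (t lam0 lam1 : nat -> R) (i j : nat) (x : R) :
  mesh n t -> sign_cond n lam0 lam1 ->
  (1 <= j < n)%nat -> t j <= x <= t (S j) -> 0 <= piece t lam0 lam1 j i x.
Proof.
  intros Ht Hl Hj Hx. destruct (Hl j) as [H0 H1]; [lia | lia |].
  assert (Hlt := Ht j ltac:(lia) ltac:(lia)).
  unfold piece. destruct Nat.eqb; [apply fall_nonneg; lra|].
  destruct Nat.eqb; [apply rise_nonneg; lra | lra].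
Qed.

Lemma span_elt_piece (n : nat) (t lam0 lam1 c : nat -> R) (j : nat) (x : R) :
  mesh n t -> sign_cond n lam0 lam1 ->
  (1 <= j < n)%nat -> t j <= x <= t (S j) ->
  span_elt n t lam0 lam1 c x =
  c j * fall (lam0 j) (lam1 j) (t j) (t (S j)) x
  + c (S j) * rise (lam0 j) (lam1 j) (t j) (t (S j)) x.
Proof.
  intros Ht Hl Hj Hx. unfold span_elt.
  rewrite (sum_eq _ (fun k => c (S k) * piece t lam0 lam1 j (S k) x)).
  2: { intros k _. f_equal. now apply hat_eq_piece. }
  (* Summand [k] belongs to hat [S k], so the falling half enters once [N] reaches [j - 1] and the
     rising half once [N] reaches [j]. *)
  assert (H : forall N, sum_f_R0 (fun k => c (S k) * piece t lam0 lam1 j (S k) x) N =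
            (if Nat.leb j (S N) then c j * fall (lam0 j) (lam1 j) (t j) (t (S j)) x else 0)
            + (if Nat.leb j N then c (S j) * rise (lam0 j) (lam1 j) (t j) (t (S j)) x else 0)).
  { induction N as [|N IH].
    - simpl sum_f_R0. destruct (Nat.leb_spec j 0); [lia|].
      destruct (Nat.leb_spec j 1).
      + replace j with 1%nat by lia. rewrite piece_same. ring.
      + rewrite piece_other by lia. ring.
    - rewrite tech5, IH.
      destruct (Nat.leb_spec j N), (Nat.leb_spec j (S N)), (Nat.leb_spec j (S (S N))); try lia.
      + rewrite piece_other by lia. ring.
      + replace j with (S N) by lia. rewrite piece_succ. ring.
      + replace j with (S (S N)) by lia. rewrite piece_same. ring.
      + rewrite piece_other by lia. ring. }
  rewrite H. destruct (Nat.leb_spec j (S (n - 1))); [| lia].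
  destruct (Nat.leb_spec j (n - 1)); [easy | lia].
Qed.

Lemma span_elt_abs_le (n : nat) (t lam0 lam1 c : nat -> R) (C x : R) :
  mesh n t -> sign_cond n lam0 lam1 -> (2 <= n)%nat ->
  (forall i, (1 <= i <= n)%nat -> Rabs (c i) <= C) ->
  t 1%nat <= x <= t n -> Rabs (span_elt n t lam0 lam1 c x) <= C.
Proof.
  intros Ht Hl Hn HC Hx.
  destruct (mesh_piece n t x Hn Hx) as [j [Hj Hxj]].
  rewrite (span_elt_piece n t lam0 lam1 c j x Ht Hl Hj Hxj).
  destruct (Hl j) as [H0 H1]; [lia | lia |].
  assert (Hlt := Ht j ltac:(lia) ltac:(lia)).
  assert (Hq := fall_nonneg (lam0 j) (lam1 j) (t j) (t (S j)) x ltac:(lra) Hlt ltac:(lra)).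
  assert (Hp := rise_nonneg (lam0 j) (lam1 j) (t j) (t (S j)) x ltac:(lra) Hlt ltac:(lra)).
  assert (Hpq := rise_add_fall_le_1 (lam0 j) (lam1 j) (t j) (t (S j)) x H0 H1 Hlt Hxj).
  set (p := rise _ _ _ _ _) in *. set (q := fall _ _ _ _ _) in *.
  assert (C1 := HC j ltac:(lia)). assert (C2 := HC (S j) ltac:(lia)).
  assert (HC0 : 0 <= C) by (assert (H := Rabs_pos (c j)); lra).
  apply Rle_trans with (1 := Rabs_triang _ _).
  rewrite !Rabs_mult, (Rabs_pos_eq p), (Rabs_pos_eq q) by assumption.
  apply Rle_trans with (C * q + C * p); [| nra].
  apply Rplus_le_compat; apply Rmult_le_compat_r; assumption.
Qed.

Lemma continuous_mult_R (f g : R -> R) (x : R) :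
  continuous f x -> continuous g x -> continuous (fun y => f y * g y) x.
Proof. apply (continuous_mult (K := R_AbsRing)). Qed.

(** The local inequalities with a constant common to all intervals. The last two bounds hold because
    [p, q <= 1]; they let diagonal dominance trade the integral of a half for that of its square. *)
Lemma piece_integral_bound (n : nat) (t lam0 lam1 : nat -> R) (j : nat) :
  mesh n t -> sign_cond n lam0 lam1 -> (1 <= j < n)%nat ->
  let p := rise (lam0 j) (lam1 j) (t j) (t (S j)) in
  let q := fall (lam0 j) (lam1 j) (t j) (t (S j)) in
  let int f := RInt f (t j) (t (S j)) in
  (/ (2 * max_bound n lam0 lam1) * int p <= int (fun x => p x * p x) - int (fun x => p x * q x) /\
   / (2 * max_bound n lam0 lam1) * int q <= int (fun x => q x * q x) - int (fun x => p x * q x))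
  /\ int (fun x => p x * p x) <= int p /\ int (fun x => q x * q x) <= int q.
Proof.
  intros Ht Hl Hj p q int.
  destruct (Hl j) as [H0 H1]; [lia | lia |].
  assert (Hlt := Ht j ltac:(lia) ltac:(lia)).
  assert (HB := bound_term_le_max n j lam0 lam1 Hj).
  assert (HB2 := bound_term_ge_2 (lam0 j) (lam1 j) H0 H1).
  assert (Ip := rise_integral_bound (lam0 j) (lam1 j) (t j) (t (S j)) H0 H1 Hlt).
  assert (Iq := fall_integral_bound (lam0 j) (lam1 j) (t j) (t (S j)) H0 H1 Hlt).
  fold p q in Ip, Iq.
  set (B := bound_term (lam0 j) (lam1 j)) in *. set (MB := max_bound n lam0 lam1) in *.
  assert (Hp : forall x, t j <= x <= t (S j) -> 0 <= p x).
  { intros x Hx. apply rise_nonneg; lra. }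
  assert (Hq : forall x, t j <= x <= t (S j) -> 0 <= q x).
  { intros x Hx. apply fall_nonneg; lra. }
  assert (Hpq : forall x, t j <= x <= t (S j) -> p x + q x <= 1).
  { intros x Hx. now apply rise_add_fall_le_1. }
  assert (Cp : forall x, continuous p x) by (intros; apply rise_continuous).
  assert (Cq : forall x, continuous q x) by (intros; apply fall_continuous).
  assert (Ip0 : 0 <= int p).
  { apply RInt_ge_0; [lra | now apply ex_RInt_of_continuous |]. intros x Hx. apply Hp. lra. }
  assert (Iq0 : 0 <= int q).
  { apply RInt_ge_0; [lra | now apply ex_RInt_of_continuous |]. intros x Hx. apply Hq. lra. }
  (* Enlarging [B] to [MB] is legitimate because [D >= 0], which follows from [0 <= I <= 2 B D] and
     [B >= 2]. *)
  assert (Hgen : forall I D, 0 <= I -> I <= 2 * B * D -> / (2 * MB) * I <= D).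
  { intros I D HI HD.
    assert (0 <= D) by nra.
    rewrite Rmult_comm. change (I / (2 * MB) <= D). apply Rle_div_l; nra. }
  repeat split.
  - now apply Hgen.
  - now apply Hgen.
  - apply RInt_le; [lra | | now apply ex_RInt_of_continuous |].
    + apply ex_RInt_of_continuous. intros x. now apply continuous_mult_R.
    + intros x Hx. specialize (Hp x ltac:(lra)). specialize (Hq x ltac:(lra)).
      specialize (Hpq x ltac:(lra)). nra.
  - apply RInt_le; [lra | | now apply ex_RInt_of_continuous |].
    + apply ex_RInt_of_continuous. intros x. now apply continuous_mult_R.
    + intros x Hx. specialize (Hp x ltac:(lra)). specialize (Hq x ltac:(lra)).
      specialize (Hpq x ltac:(lra)). nra.
Qed.

(** * Diagonal dominance of the Gram matrix *)

Lemma max_bound_ge_2 (n : nat) (lam0 lam1 : nat -> R) :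
  sign_cond n lam0 lam1 -> (2 <= n)%nat -> 2 <= max_bound n lam0 lam1.
Proof.
  intros Hl Hn. destruct (Hl 1%nat) as [H0 H1]; [lia | lia |].
  apply Rle_trans with (1 := bound_term_ge_2 _ _ H0 H1).
  apply bound_term_le_max. lia.
Qed.

(** On a piece where [H_m] has the shape [u] and the other hat the shape [v], the integral of [u v]
    is at most that of [u^2] minus [d] times that of [u], hence at most [1 - d] times that of [u^2].
    Only one neighbour of [H_m] is nonzero on such a piece, so summing over the pieces gives both
    off-diagonal entries at once. *)
Lemma gram_dominance (n : nat) (t lam0 lam1 : nat -> R) (m : nat) :
  mesh n t -> sign_cond n lam0 lam1 -> (2 <= n)%nat -> (1 <= m <= n)%nat ->
  gram n t lam0 lam1 (m - 1) m + gram n t lam0 lam1 m (m + 1) <=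
  (1 - / (2 * max_bound n lam0 lam1)) * gram n t lam0 lam1 m m.
Proof.
  intros Ht Hl Hn Hm.
  set (d := / (2 * max_bound n lam0 lam1)).
  set (H := hat n t lam0 lam1).
  set (P := piece t lam0 lam1).
  assert (HP : forall i k j, (1 <= j < n)%nat ->
            ex_RInt (fun x => H i x * H k x) (t j) (t (S j)) /\
            RInt (fun x => H i x * H k x) (t j) (t (S j)) =
            RInt (fun x => P j i x * P j k x) (t j) (t (S j))).
  { intros i k j Hj. assert (Hlt := Ht j ltac:(lia) ltac:(lia)).
    apply RInt_eq_continuous; [lra | |].
    - intros x. apply continuous_mult_R; apply piece_continuous.
    - intros x Hx. unfold H, P. f_equal; now apply hat_eq_piece. }
  assert (Hex : forall i k, ex_RInt (fun x => H i x * H k x) (t 1%nat) (t n)).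
  { intros i k. apply ex_RInt_mesh; [| lia]. intros j Hj. now apply HP. }
  unfold gram. fold H.
  change (plus (RInt (fun x => H (m - 1)%nat x * H m x) (t 1%nat) (t n))
            (RInt (fun x => H m x * H (m + 1)%nat x) (t 1%nat) (t n)) <=
          scal (1 - d) (RInt (fun x => H m x * H m x) (t 1%nat) (t n))).
  rewrite <- (RInt_plus (V := R_CompleteNormedModule)) by apply Hex.
  rewrite <- (RInt_scal (V := R_CompleteNormedModule)) by apply Hex.
  apply RInt_mesh_le; [| | | lia].
  - intros j Hj. apply (ex_RInt_plus (V := R_NormedModule)); now apply HP.
  - intros j Hj. apply (ex_RInt_scal (V := R_NormedModule)); now apply HP.
  - intros j Hj.
    rewrite (RInt_plus (V := R_CompleteNormedModule)) by now apply HP.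
    rewrite (RInt_scal (V := R_CompleteNormedModule)) by now apply HP.
    rewrite !(fun i k => proj2 (HP i k j Hj)).
    destruct (piece_integral_bound n t lam0 lam1 j Ht Hl Hj) as [[Bp Bq] [Lp Lq]].
    fold d in Bp, Bq.
    assert (Hd : 0 < d).
    { apply Rinv_0_lt_compat. assert (HB := max_bound_ge_2 n lam0 lam1 Hl Hn). lra. }
    assert (Hz : forall f, RInt (fun x => f x * 0) (t j) (t (S j)) = 0 :> R).
    { intros f. rewrite (RInt_ext _ (fun _ => 0)).
      - rewrite (RInt_const (V := R_CompleteNormedModule)). unfold scal; simpl. apply Rmult_0_r.
      - intros x _. apply Rmult_0_r. }
    assert (Hz' : forall f, RInt (fun x => 0 * f x) (t j) (t (S j)) = 0 :> R).
    { intros f. rewrite (RInt_ext _ (fun x => f x * 0)); [apply Hz|].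
      intros x _. apply Rmult_comm. }
    unfold plus, scal; simpl. unfold mult; simpl. unfold P.
    destruct (Nat.eq_dec m j) as [-> | Hmj].
    + replace (j + 1)%nat with (S j) by lia.
      rewrite piece_same, piece_succ, (piece_other _ _ _ j (j - 1)) by lia.
      rewrite Hz', (RInt_ext (fun x => fall (lam0 j) (lam1 j) (t j) (t (S j)) x
                               * rise (lam0 j) (lam1 j) (t j) (t (S j)) x)
                      (fun x => rise (lam0 j) (lam1 j) (t j) (t (S j)) x
                               * fall (lam0 j) (lam1 j) (t j) (t (S j)) x)).
      2: { intros x _. apply Rmult_comm. }
      nra.
    + destruct (Nat.eq_dec m (S j)) as [-> | HmSj].
      * replace (S j - 1)%nat with j by lia.
        rewrite piece_same, piece_succ, (piece_other _ _ _ j (S j + 1)) by lia.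
        rewrite Hz, (RInt_ext (fun x => fall (lam0 j) (lam1 j) (t j) (t (S j)) x
                                 * rise (lam0 j) (lam1 j) (t j) (t (S j)) x)
                      (fun x => rise (lam0 j) (lam1 j) (t j) (t (S j)) x
                               * fall (lam0 j) (lam1 j) (t j) (t (S j)) x)).
        2: { intros x _. apply Rmult_comm. }
        nra.
      * rewrite (piece_other _ _ _ j m) by lia. rewrite !Hz, !Hz'. lra.
Qed.

Lemma gram_nonneg (n : nat) (t lam0 lam1 : nat -> R) (i k : nat) :
  mesh n t -> sign_cond n lam0 lam1 -> (2 <= n)%nat -> 0 <= gram n t lam0 lam1 i k.
Proof.
  intros Ht Hl Hn. unfold gram. apply RInt_ge_0.
  - apply mesh_le with n; [assumption | lia | lia].
  - apply ex_RInt_mesh; [| lia]. intros j Hj.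
    assert (Hlt := Ht j ltac:(lia) ltac:(lia)).
    apply (RInt_eq_continuous _
             (fun x => piece t lam0 lam1 j i x * piece t lam0 lam1 j k x)); [lra | |].
    + intros x. apply continuous_mult_R; apply piece_continuous.
    + intros x Hx. f_equal; now apply hat_eq_piece.
  - intros x Hx. destruct (mesh_piece n t x Hn ltac:(lra)) as [j [Hj Hxj]].
    rewrite !(fun i => hat_eq_piece n t lam0 lam1 i j x Ht Hl Hj Hxj).
    apply Rmult_le_pos; now apply piece_nonneg with n.
Qed.

Lemma gram_row_diag_dominant (n : nat) (t lam0 lam1 : nat -> R) :
  mesh n t -> sign_cond n lam0 lam1 -> (2 <= n)%nat ->
  row_diag_dominant n (gram_ext n t lam0 lam1).
Proof.
  intros Ht Hl Hn.
  assert (HB := max_bound_ge_2 n lam0 lam1 Hl Hn).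
  assert (Hd : 0 < / (2 * max_bound n lam0 lam1) < 1).
  { split; [apply Rinv_0_lt_compat; lra|]. rewrite <- Rinv_1. apply Rinv_lt_contravar; lra. }
  exists (1 - / (2 * max_bound n lam0 lam1)). split; [lra|].
  intros m Hm.
  (* Off the diagonal an upper bound is enough: [gram_ext] either agrees with the nonnegative [gram]
     or is set to [0]. *)
  assert (Hle : forall i k, Rabs (gram_ext n t lam0 lam1 i k) <= gram n t lam0 lam1 i k).
  { intros i k. assert (Hg := gram_nonneg n t lam0 lam1 i k Ht Hl Hn).
    unfold gram_ext. destruct orb; [rewrite Rabs_R0; lra | rewrite Rabs_pos_eq; lra]. }
  assert (Hmm : Rabs (gram_ext n t lam0 lam1 m m) = gram n t lam0 lam1 m m).
  { assert (Hg := gram_nonneg n t lam0 lam1 m m Ht Hl Hn).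
    unfold gram_ext. destruct (Nat.eqb_spec m 0); [lia|].
    destruct (Nat.eqb_spec m (n + 1)); [lia|]. now apply Rabs_pos_eq. }
  rewrite Hmm.
  assert (H := gram_dominance n t lam0 lam1 m Ht Hl Hn Hm).
  assert (H1 := Hle (m - 1)%nat m). assert (H2 := Hle m (m + 1)%nat). lra.
Qed.

(** * Coefficients of the orthogonal projection *)

Lemma piece_residual_bound (n : nat) (t lam0 lam1 c : nat -> R) (f : R -> R) (M e : R)
  (m j : nat) :
  mesh n t -> sign_cond n lam0 lam1 -> (1 <= j < n)%nat ->
  (forall x, continuous f x) ->
  (forall x, t j <= x <= t (S j) -> Rabs (f x) <= M) ->
  Rabs e = 1 -> e * c m = Rabs (c m) ->
  (forall i, (1 <= i <= n)%nat -> Rabs (c i) <= Rabs (c m)) ->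
  let p := rise (lam0 j) (lam1 j) (t j) (t (S j)) in
  let q := fall (lam0 j) (lam1 j) (t j) (t (S j)) in
  RInt (fun x => e * ((f x - (c j * q x + c (S j) * p x)) * piece t lam0 lam1 j m x))
    (t j) (t (S j)) <=
  (M - Rabs (c m) * / (2 * max_bound n lam0 lam1)) *
  RInt (piece t lam0 lam1 j m) (t j) (t (S j)).
Proof.
  intros Ht Hl Hj Cf Hf He Hem Hc p q.
  destruct (Hl j) as [H0 H1]; [lia | lia |].
  assert (Hlt := Ht j ltac:(lia) ltac:(lia)).
  destruct (piece_integral_bound n t lam0 lam1 j Ht Hl Hj) as [[Bp Bq] _].
  fold p q in Bp, Bq.
  set (d := / (2 * max_bound n lam0 lam1)) in *.
  assert (Cp : forall x, continuous p x) by (intros; apply rise_continuous).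
  assert (Cq : forall x, continuous q x) by (intros; apply fall_continuous).
  assert (Cpc := piece_continuous t lam0 lam1 j m).
  assert (Cres : forall x, continuous
            (fun x => e * ((f x - (c j * q x + c (S j) * p x)) * piece t lam0 lam1 j m x)) x).
  { intros x. apply continuous_mult_R; [apply continuous_const|].
    apply continuous_mult_R; [| apply Cpc].
    apply (continuous_minus (V := R_NormedModule)); [apply Cf|].
    apply (continuous_plus (V := R_NormedModule)); apply continuous_mult_R;
      solve [apply continuous_const | auto]. }
  assert (Hfe : forall x, t j <= x <= t (S j) -> e * f x <= M).
  { intros x Hx. apply Rle_trans with (1 := Rle_abs _).
    rewrite Rabs_mult, He. specialize (Hf x Hx). lra. }
  assert (Hce : forall i, (1 <= i <= n)%nat -> - (e * c i) <= Rabs (c m)).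
  { intros i Hi. apply Rle_trans with (1 := Rle_abs _).
    rewrite Rabs_Ropp, Rabs_mult, He. specialize (Hc i Hi). lra. }
  (* [u] is the hat shape of [H_m] on the piece and [v] the other one *)
  assert (Hgen : forall u v : R -> R,
            (forall x, continuous u x) -> (forall x, continuous v x) ->
            (forall x, t j <= x <= t (S j) -> 0 <= u x /\ 0 <= v x) ->
            piece t lam0 lam1 j m = u ->
            (exists i, (1 <= i <= n)%nat /\
               forall x, c j * q x + c (S j) * p x = c m * u x + c i * v x) ->
            d * RInt u (t j) (t (S j)) <=
              RInt (fun x => u x * u x) (t j) (t (S j)) -
              RInt (fun x => u x * v x) (t j) (t (S j)) ->
            RInt (fun x => e * ((f x - (c j * q x + c (S j) * p x)) * piece t lam0 lam1 j m x))
              (t j) (t (S j)) <=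
            (M - Rabs (c m) * d) * RInt (piece t lam0 lam1 j m) (t j) (t (S j))).
  { intros u v Cu Cv Huv Hpu [i [Hi Hci]] Hd.
    assert (Iu := RInt_correct u (t j) (t (S j)) (ex_RInt_of_continuous _ _ _ Cu)).
    assert (Iuu := RInt_correct (fun x => u x * u x) (t j) (t (S j))
                     (ex_RInt_of_continuous _ _ _
                        (fun x => continuous_mult_R u u x (Cu x) (Cu x)))).
    assert (Iuv := RInt_correct (fun x => u x * v x) (t j) (t (S j))
                     (ex_RInt_of_continuous _ _ _
                        (fun x => continuous_mult_R u v x (Cu x) (Cv x)))).
    assert (I3 := is_RInt_lin3 _ _ _ _ _ M (- Rabs (c m)) (Rabs (c m)) _ _ _ Iu Iuu Iuv).
    rewrite Hpu in *.
    (* Pointwise, [e f u <= M u], and [e g u = |c_m| u^2 + e c_i u v >= |c_m| (u^2 - u v)] because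
       [|c_i| <= |c_m|]. The local inequality [Hd] then bounds the integral of [u^2 - u v] from
       below. *)
    apply Rle_trans with (M * RInt u (t j) (t (S j))
       + - Rabs (c m) * RInt (fun x => u x * u x) (t j) (t (S j))
       + Rabs (c m) * RInt (fun x => u x * v x) (t j) (t (S j))).
    - rewrite <- (is_RInt_unique _ _ _ _ I3).
      apply RInt_le; [lra | now apply ex_RInt_of_continuous | eexists; exact I3 |].
      intros x Hx. rewrite Hci.
      destruct (Huv x ltac:(lra)) as [Hu Hv].
      specialize (Hfe x ltac:(lra)). specialize (Hce i Hi).
      replace (e * ((f x - (c m * u x + c i * v x)) * u x))
        with (e * f x * u x + - (e * c m) * (u x * u x) + - (e * c i) * (u x * v x)) by ring.
      rewrite Hem.
      assert (e * f x * u x <= M * u x) by (apply Rmult_le_compat_r; lra).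
      assert (- (e * c i) * (u x * v x) <= Rabs (c m) * (u x * v x))
        by (apply Rmult_le_compat_r; [apply Rmult_le_pos; lra | lra]).
      lra.
    - assert (Ha := Rabs_pos (c m)).
      assert (Hm := Rmult_le_compat_l _ _ _ Ha Hd). lra. }
  assert (Hp0 : forall x, t j <= x <= t (S j) -> 0 <= p x).
  { intros x Hx. apply rise_nonneg; lra. }
  assert (Hq0 : forall x, t j <= x <= t (S j) -> 0 <= q x).
  { intros x Hx. apply fall_nonneg; lra. }
  destruct (Nat.eq_dec m j) as [Emj | Hmj].
  - apply (Hgen q p Cq Cp).
    + intros x Hx. auto.
    + rewrite Emj. apply piece_same.
    + exists (S j). split; [lia|]. intros x. now rewrite Emj.
    + rewrite (RInt_ext (fun x => q x * p x) (fun x => p x * q x)); [exact Bq|].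
      intros x _. apply Rmult_comm.
  - destruct (Nat.eq_dec m (S j)) as [EmSj | HmSj].
    + apply (Hgen p q Cp Cq).
      * intros x Hx. auto.
      * rewrite EmSj. apply piece_succ.
      * exists j. split; [lia|]. intros x. rewrite EmSj. ring.
      * exact Bp.
    + rewrite piece_other by lia.
      rewrite (RInt_ext _ (fun _ => 0)) by (intros x _; now rewrite !Rmult_0_r).
      rewrite !(RInt_const (V := R_CompleteNormedModule)).
      unfold scal; simpl. unfold mult; simpl. lra.
Qed.

Lemma hat_integrable (n : nat) (t lam0 lam1 : nat -> R) (m : nat) :
  mesh n t -> sign_cond n lam0 lam1 ->
  forall j, (1 <= j < n)%nat ->
  ex_RInt (hat n t lam0 lam1 m) (t j) (t (S j)) /\
  RInt (hat n t lam0 lam1 m) (t j) (t (S j)) = RInt (piece t lam0 lam1 j m) (t j) (t (S j)).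
Proof.
  intros Ht Hl j Hj. assert (Hlt := Ht j ltac:(lia) ltac:(lia)).
  apply RInt_eq_continuous; [lra | apply piece_continuous |].
  intros x Hx. now apply hat_eq_piece.
Qed.

Lemma hat_integral_pos (n : nat) (t lam0 lam1 : nat -> R) (m : nat) :
  mesh n t -> sign_cond n lam0 lam1 -> (2 <= n)%nat -> (1 <= m <= n)%nat ->
  0 < RInt (hat n t lam0 lam1 m) (t 1%nat) (t n).
Proof.
  intros Ht Hl Hn Hm.
  set (H := hat n t lam0 lam1 m).
  (* One interval adjacent to [t_m] suffices, as the half of the hat on it is strictly positive
     inside. The last knot has no interval to its right, so the one to its left is taken. *)
  assert (Hj : exists j, (1 <= j < n)%nat /\ (m = j \/ m = S j)).
  { destruct (Nat.eq_dec m n); [exists (n - 1)%nat | exists m]; lia. }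
  destruct Hj as [j [Hj Hmj]].
  assert (Hlt := Ht j ltac:(lia) ltac:(lia)).
  destruct (Hl j) as [H0 H1]; [lia | lia |].
  assert (Hex : forall j, (1 <= j < n)%nat -> ex_RInt H (t j) (t (S j)))
    by (intros; now apply hat_integrable).
  assert (L1 := mesh_le n t 1 j Ht ltac:(lia) ltac:(lia)).
  assert (L2 := mesh_le n t (S j) n Ht ltac:(lia) ltac:(lia)).
  assert (Hall := ex_RInt_mesh n t H Hex ltac:(lia)).
  assert (E1 : ex_RInt H (t 1%nat) (t j))
    by (apply (ex_RInt_Chasles_1 (V := R_CompleteNormedModule)) with (t n); [lra | exact Hall]).
  assert (E2 : ex_RInt H (t (S j)) (t n))
    by (apply (ex_RInt_Chasles_2 (V := R_CompleteNormedModule)) with (t 1%nat); [lra | exact Hall]).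
  assert (E3 : ex_RInt H (t j) (t n))
    by (apply (ex_RInt_Chasles_2 (V := R_CompleteNormedModule)) with (t 1%nat); [lra | exact Hall]).
  assert (Hpos : forall x, t 1%nat <= x <= t n -> 0 <= H x).
  { intros x Hx. destruct (mesh_piece n t x Hn Hx) as [k [Hk Hxk]].
    unfold H. rewrite (hat_eq_piece n t lam0 lam1 m k x Ht Hl Hk Hxk).
    now apply piece_nonneg with n. }
  rewrite <- (RInt_Chasles H _ (t j)) by assumption.
  rewrite <- (RInt_Chasles H (t j) (t (S j))) by auto.
  assert (P1 : 0 <= RInt H (t 1%nat) (t j))
    by (apply RInt_ge_0; [lra | exact E1 | intros x Hx; apply Hpos; lra]).
  assert (P2 : 0 <= RInt H (t (S j)) (t n))
    by (apply RInt_ge_0; [lra | exact E2 | intros x Hx; apply Hpos; lra]).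
  assert (P3 : 0 < RInt H (t j) (t (S j))).
  { unfold H. rewrite (proj2 (hat_integrable n t lam0 lam1 m Ht Hl j Hj)).
    apply RInt_gt_0; [lra | | intros; apply piece_continuous].
    intros x Hx. destruct Hmj as [-> | ->].
    - rewrite piece_same. rewrite <- (Ropp_involutive x), fall_opp.
      + unfold rise. apply Rdiv_lt_0_compat; apply Phi_pos; lra.
      + apply Rgt_not_eq, Phi_pos; lra.
    - rewrite piece_succ. unfold rise. apply Rdiv_lt_0_compat; apply Phi_pos; lra. }
  unfold plus; simpl. lra.
Qed.

(** Summing [piece_residual_bound] over the pieces and using orthogonality gives
    [0 <= (M - |c_m| d) I], where [I] is the integral of [H_m]; since [I > 0], it can be
    cancelled. *)
Lemma projection_coeff_bound (n : nat) (t lam0 lam1 c : nat -> R) (f : R -> R) (M : R) (m : nat) :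
  mesh n t -> sign_cond n lam0 lam1 -> (2 <= n)%nat -> (1 <= m <= n)%nat ->
  continuous_on (in_cc (t 1%nat) (t n)) f ->
  (forall x, in_cc (t 1%nat) (t n) x -> Rabs (f x) <= M) ->
  RInt (fun x => (f x - span_elt n t lam0 lam1 c x) * hat n t lam0 lam1 m x) (t 1%nat) (t n) = 0 ->
  (forall i, (1 <= i <= n)%nat -> Rabs (c i) <= Rabs (c m)) ->
  Rabs (c m) <= 2 * max_bound n lam0 lam1 * M.
Proof.
  intros Ht Hl Hn Hm Hf HM Horth Hc.
  assert (Hab := mesh_le n t 1 n Ht ltac:(lia) ltac:(lia)).
  destruct (continuous_on_extend f _ _ Hab Hf) as [ft [Cft Hft]].
  assert (Hin : forall j x, (1 <= j < n)%nat -> t j <= x <= t (S j) -> in_cc (t 1%nat) (t n) x).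
  { intros j x Hj Hx.
    assert (L1 := mesh_le n t 1 j Ht ltac:(lia) ltac:(lia)).
    assert (L2 := mesh_le n t (S j) n Ht ltac:(lia) ltac:(lia)).
    unfold in_cc. lra. }
  assert (He : exists e, Rabs e = 1 /\ e * c m = Rabs (c m)).
  { destruct (Rle_or_lt 0 (c m)).
    - exists 1. split; [apply Rabs_R1 | rewrite Rabs_pos_eq; lra].
    - exists (-1). split; [rewrite Rabs_left; lra | rewrite Rabs_left; lra]. }
  destruct He as [e [He Hem]].
  set (F := fun x => (f x - span_elt n t lam0 lam1 c x) * hat n t lam0 lam1 m x) in *.
  set (d := / (2 * max_bound n lam0 lam1)).
  (* The factor is left arbitrary: it is taken to be the sign of [c_m] in the main estimate and [1]
     for the integrability of [F] itself. *)
  assert (HF : forall e j, (1 <= j < n)%nat ->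
            ex_RInt (fun x => e * F x) (t j) (t (S j)) /\
            RInt (fun x => e * F x) (t j) (t (S j)) =
            RInt (fun x => e * ((ft x - (c j * fall (lam0 j) (lam1 j) (t j) (t (S j)) x
                          + c (S j) * rise (lam0 j) (lam1 j) (t j) (t (S j)) x))
                          * piece t lam0 lam1 j m x)) (t j) (t (S j))).
  { intros e' j Hj. assert (Hlt := Ht j ltac:(lia) ltac:(lia)).
    apply RInt_eq_continuous; [lra | |].
    - intros x. apply continuous_mult_R; [apply continuous_const|].
      apply continuous_mult_R; [| apply piece_continuous].
      apply (continuous_minus (V := R_NormedModule)); [apply Cft|].
      apply (continuous_plus (V := R_NormedModule)); apply continuous_mult_R;
        solve [apply continuous_const | apply fall_continuous | apply rise_continuous].
    - intros x Hx. unfold F. f_equal. f_equal.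
      + rewrite (Hft x) by now apply (Hin j).
        f_equal. now apply span_elt_piece.
      + now apply hat_eq_piece. }
  assert (Hmain : RInt (fun x => e * F x) (t 1%nat) (t n) <=
            RInt (fun x => (M - Rabs (c m) * d) * hat n t lam0 lam1 m x) (t 1%nat) (t n)).
  { apply RInt_mesh_le; [| | | lia].
    - intros j Hj. now apply HF.
    - intros j Hj. apply (ex_RInt_scal (V := R_NormedModule)). now apply hat_integrable.
    - intros j Hj.
      rewrite (proj2 (HF e j Hj)).
      rewrite (RInt_mult_l _ (hat n t lam0 lam1 m)) by now apply hat_integrable.
      rewrite (proj2 (hat_integrable n t lam0 lam1 m Ht Hl j Hj)).
      apply piece_residual_bound; auto.
      intros x Hx. rewrite Hft by now apply (Hin j). apply HM. now apply (Hin j). }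
  assert (HexF : ex_RInt F (t 1%nat) (t n)).
  { apply (ex_RInt_ext (fun x => 1 * F x)); [intros x _; apply Rmult_1_l|].
    apply ex_RInt_mesh; [| lia]. intros j Hj. now apply HF. }
  assert (HexH : ex_RInt (hat n t lam0 lam1 m) (t 1%nat) (t n)).
  { apply ex_RInt_mesh; [| lia]. intros j Hj. now apply hat_integrable. }
  rewrite (RInt_mult_l _ F), (RInt_mult_l _ (hat n t lam0 lam1 m)), Horth in Hmain by assumption.
  assert (Hpos := hat_integral_pos n t lam0 lam1 m Ht Hl Hn Hm).
  set (I := RInt (hat n t lam0 lam1 m) (t 1%nat) (t n)) in *.
  assert (Hcm : Rabs (c m) * d <= M) by nra.
  assert (HB := max_bound_ge_2 n lam0 lam1 Hl Hn).
  assert (Hcm' : Rabs (c m) / (2 * max_bound n lam0 lam1) <= M) by exact Hcm.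
  apply Rle_div_l in Hcm'; lra.
Qed.

Theorem mainTheorem18 (n : nat) (t lam0 lam1 : nat -> R)
  (Hn : (3 <= n)%nat)
  (Ht : forall i : nat, (1 <= i)%nat -> (i < n)%nat -> t i < t (S i))
  (Hlam : forall j : nat, (1 <= j)%nat -> (j <= n - 1)%nat ->
            lam0 j < 0 /\ 0 < lam1 j) :
  row_diag_dominant n (gram_ext n t lam0 lam1) /\
  (forall (f g : R -> R) (M : R),
     continuous_on (in_cc (t 1%nat) (t n)) f ->
     is_orth_proj n t lam0 lam1 f g ->
     (forall x, in_cc (t 1%nat) (t n) x -> Rabs (f x) <= M) ->
     forall x, in_cc (t 1%nat) (t n) x ->
       Rabs (g x) <= 2 * max_bound n lam0 lam1 * M).
Proof.
  split; [apply gram_row_diag_dominant; auto; lia|].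
  intros f g M Hf [[c Hg] Horth] HM x Hx.
  destruct (max_abs_index n c ltac:(lia)) as [m [Hm Hmax]].
  rewrite Hg.
  apply span_elt_abs_le; auto; [lia|].
  intros i Hi. apply Rle_trans with (1 := Hmax i Hi).
  apply projection_coeff_bound with (t := t) (f := f); auto; [lia|].
  rewrite <- (Horth m Hm). apply RInt_ext. intros z _. now rewrite Hg.
Qed.
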